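(* Let $(H,\cdot,\circ)$ be a skew left brace and $I$ an abelian group viewed as a trivial brace. Let $\mathcal{H}=(H^{(\cdot)},H^{(\circ)},\lambda^H,\mathrm{id}_H)$ and let $\mathcal{I}=(I^{(\cdot)},I^{(\cdot)},\lambda^I,\mathrm{id}_I)$ be viewed as an $\mathcal{H}$-module with respect to the action $(\nu,\mu,\sigma,f)$. Then the diagram $$\begin{array}{ccc}\mathrm{H}^2_{RRB}(\mathcal{H},\mathcal{I})&\xrightarrow{\ \Omega_{RB}\ }&\mathrm{H}^2_{RB}(\widetilde H,\widetilde I)\\ {\scriptstyle\Psi}\downarrow&&\downarrow{\scriptstyle\widetilde\Psi}\\ \mathrm{H}^2_{SB}(H,I)&\xrightarrow{\ \Omega_{SB}\ }&\mathrm{H}^2_{SB}(\widetilde H,\widetilde I)\end{array}$$ commutes, i.e. $\widetilde\Psi\,\Omega_{RB}=\Omega_{SB}\,\Psi$, where $\mathrm{H}^2_{RB}$ and $\mathrm{H}^2_{SB}$ are the cohomologies with respect to the induced module structures.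
   Context: **Skew braces, squares.** A skew left brace is $(H,\cdot,\circ)$ with $H^{(\cdot)}=(H,\cdot)$, $H^{(\circ)}=(H,\circ)$ groups and $a\circ(b\cdot c)=(a\circ b)\cdot a^{-1}\cdot(a\circ c)$; $a^{-1}$, $a^\dagger$ are the inverses in $H^{(\cdot)}$, $H^{(\circ)}$; $\lambda^H_a(b)=a^{-1}\cdot(a\circ b)$ (written $\lambda$), so $\lambda:H^{(\circ)}\to\mathrm{Aut}(H^{(\cdot)})$ is a homomorphism. $I$ as a trivial brace has $\circ=\cdot$ and $\lambda^I$ trivial. The square $(\widetilde H,\bullet,\odot)$ is the skew left brace on $H\times H$ with $(h_1,g_1)\bullet(h_2,g_2)=(h_1\cdot\lambda_{g_1}(h_2),g_1\circ g_2)$, $(h_1,g_1)\odot(h_2,g_2)=(h_1\circ h_2,h_1\circ g_2\circ h_1^\dagger\circ g_1)$. It is induced by the Rota--Baxter operator $\widetilde R(h,g)=(1,g^\dagger\circ h)$ on the group $(\widetilde H,\bullet)$, i.e. $x\odot y=x\bullet\widetilde R(x)\bullet y\bullet\widetilde R(x)^{-1}$. $\widetilde I=I\times I$ is a trivial brace, with operator $R_{\widetilde I}(k,l)=(1,l^{-1}k)$. All maps called normalized are trivial when some argument is $1$. **The module.** $\mathcal{H}$ is a relative Rota--Baxter group (a relative Rota--Baxter group is $(A,B,\beta,T)$ with $\beta:B\to\mathrm{Aut}(A)$ a homomorphism and $T(a_1)T(a_2)=T(a_1\beta_{T(a_1)}(a_2))$). That $\mathcal{I}$ is an $\mathcal{H}$-module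 with action $(\nu,\mu,\sigma,f)$ means: $\nu:H^{(\circ)}\to\mathrm{Aut}(I)$ is a homomorphism; $\mu:H^{(\cdot)}\to\mathrm{Aut}(I)$ and $\sigma:H^{(\circ)}\to\mathrm{Aut}(I)$ are anti-homomorphisms; $f:I\times H\to I$ satisfies $f(l_1l_2,h)=f(l_1,h)f(l_2,h)$, $f(l,h_1\cdot h_2)=\mu_{h_2}(f(l,h_1))f(l,h_2)$; $\nu_h^{-1}(\mu_h(k)f(k,h))=\sigma_h(k)$; $\nu_b(\mu_a(k))=\mu_{\lambda_b(a)}(\nu_b(k))$. **$\mathrm{H}^2_{RRB}(\mathcal{H},\mathcal{I})=\mathrm{Z}^2/\mathrm{B}^2$.** $\mathrm{Z}^2$: quadruples of normalized maps $\tau_1,\tau_2,\rho:H\times H\to I$, $\chi:H\to I$ with - $\tau_1(a_2,a_3)\tau_1(a_1,a_2\cdot a_3)=\tau_1(a_1\cdot a_2,a_3)\mu_{a_3}(\tau_1(a_1,a_2))$, - $\tau_2(b_2,b_3)\tau_2(b_1,b_2\circ b_3)=\tau_2(b_1\circ b_2,b_3)\sigma_{b_3}(\tau_2(b_1,b_2))$, - $\rho(\lambda_{b_2}(a),b_1)\nu_{b_1}(\rho(a,b_2))=\rho(a,b_1\circ b_2)\nu_{b_1\circ b_2}(f(\tau_2(b_1,b_2),a))$, - $\rho(a_1\cdot a_2,b)\nu_b(\tau_1(a_1,a_2))=\mu_{\lambda_b(a_2)}(\rho(a_1,b))\rho(a_2,b)\tau_1(\lambda_b(a_1),\lambda_b(a_2))$,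 - $\tau_2(a_1,a_2)\chi(a_2)\chi(a_1\circ a_2)^{-1}\sigma_{a_2}(\chi(a_1))=\nu^{-1}_{a_1\circ a_2}\big(\rho(a_2,a_1)\tau_1(a_1,\lambda_{a_1}(a_2))\nu_{a_1}(f(\chi(a_1),a_2))\big)$. $\mathrm{B}^2$: those for which there are normalized $\kappa_1,\kappa_2:H\to I$ with $\tau_1(a_1,a_2)=\kappa_1(a_1\cdot a_2)^{-1}\kappa_1(a_2)\mu_{a_2}(\kappa_1(a_1))$, $\tau_2(b_1,b_2)=\kappa_2(b_1\circ b_2)^{-1}\kappa_2(b_2)\sigma_{b_2}(\kappa_2(b_1))$, $\rho(a,b)=\nu_b(f(\kappa_2(b),a)\kappa_1(a))\kappa_1(\lambda_b(a))^{-1}$, $\chi(a)=\nu_a^{-1}(\kappa_1(a))\kappa_2(a)^{-1}$. **$\mathrm{H}^2_{SB}$.** For a skew left brace $M$, an abelian group $J$, a homomorphism $\xi:M^{(\circ)}\to\mathrm{Aut}(J)$ and anti-homomorphisms $\zeta:M^{(\cdot)}\to\mathrm{Aut}(J)$, $\epsilon:M^{(\circ)}\to\mathrm{Aut}(J)$ forming a good triplet ($\xi_{m_1\cdot m_2}(\epsilon_{m_1\cdot m_2}(y))\zeta_{m_2}(y)=\zeta_{m_2}(\xi_{m_1}(\epsilon_{m_1}(y)))\xi_{m_2}(\epsilon_{m_2}(y))$ and $\zeta_{m_1^{-1}\cdot(m_1\circ m_2)}(\xi_{m_1}(y))=\xi_{m_1}(\zeta_{m_2}(y))$), $\mathrm{Z}^2_{SB}(M,J)$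 is the group of pairs of normalized maps $g,p:M\times M\to J$ with - $g(m_2,m_3)g(m_1\cdot m_2,m_3)^{-1}g(m_1,m_2\cdot m_3)\zeta_{m_3}(g(m_1,m_2))^{-1}=1$, - $\xi_{m_1}(p(m_2,m_3))p(m_1\circ m_2,m_3)^{-1}p(m_1,m_2\circ m_3)\,\xi_{m_1\circ m_2\circ m_3}(\epsilon_{m_3}(\xi^{-1}_{m_1\circ m_2}(p(m_1,m_2))))^{-1}=1$, - $\xi_{m_1}(g(m_2,m_3))\zeta_{m_1\circ m_3}(g(m_1,m_1^{-1}))\zeta_{m_1\circ m_3}(g(m_1\circ m_2,m_1^{-1}))^{-1}g((m_1\circ m_2)\cdot m_1^{-1},m_1\circ m_3)^{-1}\zeta_{m_1^{-1}\cdot(m_1\circ m_3)}(p(m_1,m_2))^{-1}p(m_1,m_2\cdot m_3)p(m_1,m_3)^{-1}=1$; $\mathrm{B}^2_{SB}(M,J)$ consists of $g(m_1,m_2)=\theta(m_1\cdot m_2)^{-1}\zeta_{m_2}(\theta(m_1))\theta(m_2)$, $p(m_1,m_2)=\theta(m_1\circ m_2)^{-1}\xi_{m_1\circ m_2}(\epsilon_{m_2}(\xi_{m_1}^{-1}(\theta(m_1))))\xi_{m_1}(\theta(m_2))$ with $\theta:M\to J$, $\theta(1)=1$; $\mathrm{H}^2_{SB}=\mathrm{Z}^2_{SB}/\mathrm{B}^2_{SB}$. $\mathrm{H}^2_{SB}(H,I)$ is taken with respect to $\xi=\nu$, $\zeta=\mu$, $\epsilon=\sigma$. $\mathrm{H}^2_{SB}(\widetilde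 H,\widetilde I)$ (additive operation $\bullet$, multiplicative $\odot$) is taken with respect to $\widetilde\xi_{(h,g)}(a,b)=(\xi_{g^\dagger\circ h}(a),\epsilon_{h^\dagger\circ g}(b))$, $\widetilde\zeta_{(h,g)}(a,b)=(\xi_g^{-1}(\zeta_h(a)\zeta_h(b^{-1})\xi_h(\epsilon_h(b))),\epsilon_g(b))$, $\widetilde\epsilon_{(h,g)}(a,b)=(\epsilon_h(a),\epsilon_h(a\,\epsilon_g^{-1}(a^{-1}b)))$. **$\mathrm{H}^2_{RB}(\widetilde H,\widetilde I)$.** Let $\gamma_{(h,g)}(k,l)=(\nu_g^{-1}(\mu_h(k)f(l,h)),\sigma_g(l))$, an anti-homomorphism $(\widetilde H,\bullet)\to\mathrm{Aut}(\widetilde I)$. Writing $xy$ for $x\bullet y$, inverses in $(\widetilde H,\bullet)$, and $R_j=\widetilde R(x_j)$, $\mathrm{Z}^2_{RB}(\widetilde H,\widetilde I)$ is the group of pairs of normalized maps $\tau:\widetilde H\times\widetilde H\to\widetilde I$, $r:\widetilde H\to\widetilde I$ with $\tau(x_2,x_3)\tau(x_1,x_2x_3)=\tau(x_1x_2,x_3)\gamma_{x_3}(\tau(x_1,x_2))$ and $$\tau(R_1,R_2)\gamma_{R_2}(r(x_1))r(x_2)=r(x_1\odot x_2)\,R_{\widetilde I}\Big(\gamma_{R_2}\big(\gamma_{x_2}(r(x_1))r(x_1)^{-1}\big)\gamma_{R_1R_2}\big(\tau(x_1R_1,x_2R_1^{-1})\gamma_{x_2R_1^{-1}}(\tau(x_1,R_1))\tau(x_2,R_1^{-1})\tau(R_1,R_1^{-1})^{-1}\big)\Big);$$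 $\mathrm{B}^2_{RB}$ consists of $\tau(x_1,x_2)=\theta(x_2)\theta(x_1x_2)^{-1}\gamma_{x_2}(\theta(x_1))$, $r(x)=R_{\widetilde I}(\gamma_{\widetilde R(x)}(\theta(x)))\theta(\widetilde R(x))^{-1}$ with $\theta(1)=1$; $\mathrm{H}^2_{RB}=\mathrm{Z}^2_{RB}/\mathrm{B}^2_{RB}$. **The four maps** (well-defined homomorphisms). - $\Psi([\tau_1,\tau_2,\rho,\chi])=[\tau_1,\hat\tau_2]$, $\hat\tau_2(h_1,h_2)=\tau_1(h_1,\lambda_{h_1}(h_2))\,\rho(h_2,h_1)\,\nu_{h_1}(f(\chi(h_1),h_2))$. - $\Omega_{RB}([\tau_1,\tau_2,\rho,\chi])=[\tau,r]$, $\tau((h_1,g_1),(h_2,g_2))=\big(\nu^{-1}_{g_1\circ g_2}(\tau_1(h_1,\lambda_{g_1}(h_2))\rho(h_2,g_1)),\ \tau_2(g_1,g_2)\big)$, $r(h,g)=\big(1,\ \tau_2(g,g^\dagger\circ h)^{-1}\chi(h)\big)$. - $\widetilde\Psi([\tau,r])=[\tau,\beta]$, where with $R_1=\widetilde R(x_1)$, $\beta(x_1,x_2)=\tau(x_1,R_1x_2R_1^{-1})\,\tau(R_1x_2,R_1^{-1})\,\gamma_{R_1^{-1}}\big(\tau(R_1,x_2)\gamma_{x_2}(r(x_1))r(x_1)^{-1}\big)\,\tau(R_1,R_1^{-1})^{-1}$. - $\Omega_{SB}([\tau_1,\tau_2])=[\tau,\tau']$ for $[\tau_1,\tau_2]\in\mathrm{H}^2_{SB}(H,I)$,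 where $\tau((h_1,g_1),(h_2,g_2))=\Big(\xi^{-1}_{g_1\circ g_2}\big(\tau_1(h_1,\lambda_{g_1}(h_2))\tau_1(g_1^{-1},g_1\circ h_2)\zeta_{g_1\circ h_2}(\tau_1(g_1,g_1^{-1})^{-1})\tau_2(g_1,h_2)\big),\ \xi^{-1}_{g_1\circ g_2}(\tau_2(g_1,g_2))\Big)$ and, with $u=h_1\circ g_2\circ h_1^\dagger\circ g_1$, $\tau'((h_1,g_1),(h_2,g_2))=\Big(\xi_u^{-1}(\tau_2(h_1,h_2)),\ \xi_u^{-1}(\tau_2(h_1\circ g_2,h_1^\dagger\circ g_1))\,\epsilon_{h_1^\dagger\circ g_1}\big(\xi^{-1}_{h_1\circ g_2}(\tau_2(h_1,g_2))\big)\,\xi_{g_1}^{-1}(\tau_2(h_1,h_1^\dagger\circ g_1))^{-1}\Big)$. (Equivalently, $\Omega_{SB}$ sends the class of an extension $E$ of $H$ by $I$ to that of the induced extension $\widetilde E$ of squares.) *)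

(* Defs.v *)
From HB Require Import structures.
From mathcomp Require Import all_boot all_algebra generic_quotient ring_quotient.
From mathcomp Require Import boolp functions.

Set Implicit Arguments.
Unset Strict Implicit.
Unset Printing Implicit Defensive.

Import GRing.Theory.

(* Groups are multiplicative (group_scope: 1, *, ^-1) and the abelian         *)
(* coefficient groups are zmodTypes, hence additive (ring_scope: 0, +, -).    *)
Local Open Scope ring_scope.
Local Open Scope group_scope.

Reserved Notation "a \circ b" (at level 40, left associativity).

(* Skew left braces: [a * b] is the additive and [a \circ b] the              *)
(* multiplicative operation; [a^-1] and [cinv a] are the respective inverses. *)

HB.mixin Record Group_isSkewBrace H of Group H := {
  circ : H -> H -> H;
  cone : H;
  cinv : H -> H;
  circA : associative circ;
  circ1e : left_id cone circ;
  circe1 : right_id cone circ;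
  circVe : left_inverse cone cinv circ;
  circeV : right_inverse cone cinv circ;
  circ_brace : forall a b c, circ a (b * c) = circ a b * a^-1 * circ a c
}.

#[short(type="skewBraceType")]
HB.structure Definition SkewBrace := {H of Group_isSkewBrace H & Group H}.

Bind Scope group_scope with SkewBrace.sort.

Notation "a \circ b" := (circ a b) : group_scope.

Definition lam (H : skewBraceType) (a b : H) : H := a^-1 * (a \circ b).

Section SkewBraceTheory.
Variable H : skewBraceType.
Implicit Types a b c : H.

Lemma coneE : @cone H = 1.
Proof.
have := circ_brace (@cone H) 1 1; rewrite !circ1e mulg1 mul1g => e.
by apply: (can_inj invgK); rewrite invg1 -[LHS]mulg1.
Qed.

Lemma circ1g a : 1 \circ a = a. Proof. by rewrite -coneE circ1e. Qed.
Lemma circg1 a : a \circ 1 = a. Proof. by rewrite -coneE circe1. Qed.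
Lemma circVg a : cinv a \circ a = 1. Proof. by rewrite circVe coneE. Qed.
Lemma circgV a : a \circ cinv a = 1. Proof. by rewrite circeV coneE. Qed.

Lemma circKg a b : cinv a \circ (a \circ b) = b.
Proof. by rewrite circA circVg circ1g. Qed.
Lemma circVKg a b : a \circ (cinv a \circ b) = b.
Proof. by rewrite circA circgV circ1g. Qed.
Lemma circgK a b : b \circ a \circ cinv a = b.
Proof. by rewrite -circA circgV circg1. Qed.
Lemma circgVK a b : b \circ cinv a \circ a = b.
Proof. by rewrite -circA circVg circg1. Qed.

Lemma cinvK a : cinv (cinv a) = a.
Proof. by rewrite -[LHS]circg1 -(circVg a) circKg. Qed.

Lemma cinvM a b : cinv (a \circ b) = cinv b \circ cinv a.
Proof.
by rewrite -[RHS]circg1 -(circgV (a \circ b)) -!circA !circKg.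
Qed.

Lemma cinv1 : cinv (1 : H) = 1.
Proof. by rewrite -[LHS]circg1 circVg. Qed.

Lemma circE a b : a \circ b = a * lam a b.
Proof. by rewrite /lam mulVKg. Qed.

Lemma lam1 a : lam a 1 = 1. Proof. by rewrite /lam circg1 mulVg. Qed.
Lemma lam1l a : lam 1 a = a. Proof. by rewrite /lam circ1g invg1 mul1g. Qed.

Lemma lamM a b c : lam a (b * c) = lam a b * lam a c.
Proof. by rewrite /lam circ_brace !mulgA. Qed.

Lemma lamV a b : lam a b^-1 = (lam a b)^-1.
Proof.
by apply: (mulIg (lam a b)); rewrite mulVg -lamM mulVg lam1.
Qed.

Lemma lam_circ a b c : lam (a \circ b) c = lam a (lam b c).
Proof.
apply: (mulgI (a \circ b)); rewrite -circE -circA [b \circ c]circE circ_brace.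
by rewrite -mulgA.
Qed.

Lemma lamK a b : lam (cinv a) (lam a b) = b.
Proof. by rewrite -lam_circ circVg lam1l. Qed.

Lemma lamVK a b : lam a (lam (cinv a) b) = b.
Proof. by rewrite -lam_circ circgV lam1l. Qed.

End SkewBraceTheory.

Definition square (H : skewBraceType) : Type := (H * H)%type.

HB.instance Definition _ (H : skewBraceType) := Choice.on (square H).

Section Square.
Variable H : skewBraceType.
Implicit Types x y z : square H.

Definition sq_mul x y : square H := (x.1 * lam x.2 y.1, x.2 \circ y.2).
Definition sq_one : square H := (1, 1).
Definition sq_inv x : square H := (lam (cinv x.2) x.1^-1, cinv x.2).
Definition sq_circ x y : square H :=
  (x.1 \circ y.1, x.1 \circ y.2 \circ cinv x.1 \circ x.2).
Definition sq_cinv x : square H :=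
  (cinv x.1, cinv x.1 \circ cinv x.2 \circ x.1).

Lemma sq_mulA : associative sq_mul.
Proof.
by move=> x y z; rewrite /sq_mul /= lamM lam_circ mulgA circA.
Qed.

Lemma sq_mul1 : left_id sq_one sq_mul.
Proof. by case=> a b; rewrite /sq_mul /= lam1l mul1g circ1g. Qed.

Lemma sq_mulr1 : right_id sq_one sq_mul.
Proof. by case=> a b; rewrite /sq_mul /= lam1 mulg1 circg1. Qed.

Lemma sq_mulV : left_inverse sq_one sq_inv sq_mul.
Proof.
by move=> x; rewrite /sq_mul /= -lamM mulVg lam1 circVg.
Qed.

Lemma sq_mulrV : right_inverse sq_one sq_inv sq_mul.
Proof. by move=> x; rewrite /sq_mul /= lamVK mulgV circgV. Qed.

HB.instance Definition _ := isGroup.Build (square H)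
  sq_mulA sq_mul1 sq_mulr1 sq_mulV sq_mulrV.

Lemma sq_circA : associative sq_circ.
Proof.
by move=> x y z; rewrite /sq_circ /= cinvM !circA circgVK.
Qed.

Lemma sq_circ1 : left_id sq_one sq_circ.
Proof. by case=> a b; rewrite /sq_circ /= !circ1g cinv1 !circg1. Qed.

Lemma sq_circr1 : right_id sq_one sq_circ.
Proof. by case=> a b; rewrite /sq_circ /= !circg1 circgV circ1g. Qed.

Lemma sq_circV : left_inverse sq_one sq_cinv sq_circ.
Proof.
by move=> x; rewrite /sq_circ /= cinvK circVg !circA !(circgVK, circgK) circVg.
Qed.

Lemma sq_circrV : right_inverse sq_one sq_cinv sq_circ.
Proof.
by move=> x; rewrite /sq_circ /= circgV !circA circgV circ1g circgK circVg.
Qed.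

(* The Rota-Baxter operator inducing sq_circ. *)
Definition rbR x : square H := (1, cinv x.2 \circ x.1).

Lemma sq_circE x y : sq_circ x y = x * rbR x * y * (rbR x)^-1.
Proof.
rewrite /(_ * _) /= /sq_mul /= lam1 mulg1 circVKg -circE invg1 !lam1 mulg1.
by rewrite cinvM cinvK !circA.
Qed.

Lemma sq_circ_brace x y z :
  sq_circ x (y * z) = sq_circ x y * x^-1 * sq_circ x z.
Proof. by rewrite !sq_circE !mulgA !mulgVK. Qed.

HB.instance Definition _ := Group_isSkewBrace.Build (square H)
  sq_circA sq_circ1 sq_circr1 sq_circV sq_circrV sq_circ_brace.

End Square.

(* Homomorphisms and anti-homomorphisms from a group to Aut(J). Invertibility *)
(* is automatic: [alpha g^-1] is inverse to [alpha g]; accordingly, inverse   *)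
(* automorphisms such as nu_b^-1 are written [nu (cinv b)] below.             *)

Record aut_hom (G : Type) (op : G -> G -> G) (e : G) (J : zmodType)
    (alpha : G -> J -> J) : Prop := AutHom {
  aut_homD : forall g, {morph alpha g : x y / x + y};
  aut_hom1 : forall x, alpha e x = x;
  aut_homM : forall g h x, alpha (op g h) x = alpha g (alpha h x)
}.

Record aut_antihom (G : Type) (op : G -> G -> G) (e : G) (J : zmodType)
    (alpha : G -> J -> J) : Prop := AutAntihom {
  aut_antihomD : forall g, {morph alpha g : x y / x + y};
  aut_antihom1 : forall x, alpha e x = x;
  aut_antihomM : forall g h x, alpha (op g h) x = alpha h (alpha g x)
}.

(* Module structures, with respect to (nu, mu, sigma, f), of                  *)
(* (I, I, trivial action, id) over the relative Rota-Baxter group             *)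
(* (H^(.), H^(o), lam, id).                                                   *)
Record rrbModule (H : skewBraceType) (I : zmodType) := RRBModule {
  nu : H -> I -> I;
  mu : H -> I -> I;
  sigma : H -> I -> I;
  mf : I -> H -> I;
  nuP : aut_hom (@circ H) 1 nu;
  muP : aut_antihom *%g 1 mu;
  sigmaP : aut_antihom (@circ H) 1 sigma;
  mfD : forall l1 l2 h, mf (l1 + l2) h = mf l1 h + mf l2 h;
  mfM : forall l h1 h2, mf l (h1 * h2) = mu h2 (mf l h1) + mf l h2;
  nu_sigma : forall h k, nu (cinv h) (mu h k + mf k h) = sigma h k;
  nu_mu : forall a b k, nu b (mu a k) = mu (lam b a) (nu b k)
}.

Record goodTriplet (M : skewBraceType) (J : zmodType) := GoodTriplet {
  xi : M -> J -> J;
  zeta : M -> J -> J;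
  eps : M -> J -> J;
  xiP : aut_hom (@circ M) 1 xi;
  zetaP : aut_antihom *%g 1 zeta;
  epsP : aut_antihom (@circ M) 1 eps;
  good1 : forall m1 m2 y,
    xi (m1 * m2) (eps (m1 * m2) y) + zeta m2 y
    = zeta m2 (xi m1 (eps m1 y)) + xi m2 (eps m2 y);
  good2 : forall m1 m2 y,
    zeta (m1^-1 * (m1 \circ m2)) (xi m1 y) = xi m1 (zeta m2 y)
}.

Lemma morph0 (V W : zmodType) (alpha : V -> W) :
  {morph alpha : u w / u + w} -> alpha 0 = 0.
Proof. by move=> D; apply: (addrI (alpha 0)); rewrite -D !addr0. Qed.

Lemma morphN (V W : zmodType) (alpha : V -> W) :
  {morph alpha : u w / u + w} -> {morph alpha : u / - u}.
Proof.
by move=> D u; apply: (addrI (alpha u)); rewrite -D !subrr (morph0 D).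
Qed.

Lemma morphB (V W : zmodType) (alpha : V -> W) :
  {morph alpha : u w / u + w} -> {morph alpha : u w / u - w}.
Proof. by move=> D u w; rewrite D (morphN D). Qed.

Lemma subDD (V : zmodType) (a a' b b' : V) :
  (a - a') + (b - b') = (a + b) - (a' + b').
Proof. by rewrite opprD addrACA. Qed.

Lemma subNN (V : zmodType) (a a' : V) : - (a - a') = - a - - a'.
Proof. by rewrite opprD. Qed.

Section Induced.
Variables (H : skewBraceType) (I : zmodType) (A : rrbModule H I).

Lemma nu_sigma_mu h y : nu A h (sigma A h y) = mu A h y + mf A y h.
Proof. by rewrite -nu_sigma -(aut_homM (nuP A)) circgV (aut_hom1 (nuP A)). Qed.

Lemma module_good1 m1 m2 y :
  nu A (m1 * m2) (sigma A (m1 * m2) y) + mu A m2 y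
  = mu A m2 (nu A m1 (sigma A m1 y)) + nu A m2 (sigma A m2 y).
Proof.
rewrite !nu_sigma_mu mfM (aut_antihomM (muP A)) (aut_antihomD (muP A)).
by rewrite -!addrA; congr (_ + (_ + _)); rewrite addrC.
Qed.

Definition rrb_triplet : goodTriplet H I :=
  GoodTriplet (nuP A) (muP A) (sigmaP A) module_good1
    (fun m1 m2 y => esym (nu_mu A m2 m1 y)).

End Induced.

Section SquareTriplet.
Variables (H : skewBraceType) (I : zmodType) (T : goodTriplet H I).
Implicit Types (x y : square H) (v w : I * I).

(* The module structure on I * I over the square of H induced by T. *)
Definition sq_xi x v : I * I :=
  (xi T (cinv x.2 \circ x.1) v.1, eps T (cinv x.1 \circ x.2) v.2).

Definition sq_zeta x v : I * I :=
  (xi T (cinv x.2)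
     (zeta T x.1 v.1 + zeta T x.1 (- v.2) + xi T x.1 (eps T x.1 v.2)),
   eps T x.2 v.2).

Definition sq_eps x v : I * I :=
  (eps T x.1 v.1, eps T x.1 (v.1 + eps T (cinv x.2) (- v.1 + v.2))).

Let xiD := aut_homD (xiP T).
Let xi1 := aut_hom1 (xiP T).
Let xiM := aut_homM (xiP T).
Let zetaD := aut_antihomD (zetaP T).
Let zeta1 := aut_antihom1 (zetaP T).
Let zetaM := aut_antihomM (zetaP T).
Let epsD := aut_antihomD (epsP T).
Let eps1 := aut_antihom1 (epsP T).
Let epsM := aut_antihomM (epsP T).

Let xiN h := morphN (xiD h).
Let zetaN h := morphN (zetaD h).
Let epsN h := morphN (epsD h).

Let del h b := - zeta T h b + xi T h (eps T h b).

Let delD h : {morph del h : u w / u + w}.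
Proof. by move=> u w; rewrite /del epsD xiD zetaD opprD addrACA. Qed.

Let xi_eps h b : xi T h (eps T h b) = zeta T h b + del h b.
Proof. by rewrite /del addNKr. Qed.

Let del1 b : del 1 b = 0.
Proof. by rewrite /del zeta1 eps1 xi1 addNr. Qed.

Let delM h1 h2 b : del (h1 * h2) b = zeta T h2 (del h1 b) + del h2 b.
Proof.
have := good1 T h1 h2 b; rewrite !xi_eps zetaD zetaM.
move: (del (h1 * h2) b) (del h1 b) (del h2 b) => d d1 d2; rewrite -!addrA => /addrI.
by rewrite (addrC (zeta T h2 b) d2) addrA => /addIr.
Qed.

Let zeta_xi a b k : zeta T (lam a b) (xi T a k) = xi T a (zeta T b k).
Proof. exact: good2. Qed.

Let del_lam g h b : del (lam g h) b = xi T g (del h (eps T g b)).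
Proof.
apply: (addrI (zeta T (lam g h) (xi T g (eps T g b)))).
rewrite {1}xi_eps zetaD -zetaM -addrA -delM -circE -xi_eps xiM epsM.
by rewrite zeta_xi -xiD -xi_eps.
Qed.

Let zeta_xiV a b k :
  xi T (cinv a) (zeta T (lam a b) k) = zeta T b (xi T (cinv a) k).
Proof.
by rewrite -[in LHS](xi1 k) -(circgV a) xiM zeta_xi -xiM circVg xi1.
Qed.

Lemma sq_zetaE x v :
  sq_zeta x v
  = (xi T (cinv x.2) (zeta T x.1 v.1 + del x.1 v.2), eps T x.2 v.2).
Proof. by rewrite /sq_zeta zetaN /del -addrA. Qed.

Lemma sq_xiP : aut_hom (@circ (square H)) 1 sq_xi.
Proof.
split=> [x v w|v|x y v].
- by rewrite /sq_xi /= xiD epsD.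
- by case: v => a b; rewrite /sq_xi /= cinv1 circ1g xi1 eps1.
rewrite -[x \circ y]/(sq_circ x y) /sq_xi /= -xiM -epsM !cinvM cinvK !circA.
by rewrite !circgVK.
Qed.

Lemma sq_zetaP : aut_antihom ( *%g : square H -> _) 1 sq_zeta.
Proof.
split=> [x v w|v|x y v].
- rewrite !sq_zetaE zetaD delD epsD.
  by apply: injective_projections => //=; rewrite -xiD addrACA.
- by case: v => a b; rewrite sq_zetaE /= cinv1 xi1 del1 addr0 zeta1 eps1.
rewrite -[x * y]/(sq_mul x y) !sq_zetaE /= epsM cinvM xiM zetaM delM del_lam.
congr (xi T _ _, _); rewrite addrA -zetaD [LHS]xiD zeta_xiV -xiM circVg.
by rewrite xi1.
Qed.

Lemma sq_epsE x v :
  sq_eps x v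
  = (eps T x.1 v.1, eps T x.1 v.1 + eps T (cinv x.2 \circ x.1) (- v.1 + v.2)).
Proof. by rewrite /sq_eps epsD -epsM. Qed.

Lemma sq_epsP : aut_antihom (@circ (square H)) 1 sq_eps.
Proof.
split=> [x v w|v|x y v].
- rewrite !sq_epsE; apply: injective_projections; rewrite /= epsD //.
  by rewrite opprD addrACA epsD addrACA.
- case: v => a b; rewrite sq_epsE /= cinv1 circ1g !eps1.
  by rewrite addrA subrr add0r.
rewrite -[x \circ y]/(sq_circ x y) !sq_epsE /= addKr -!epsM !cinvM cinvK.
by rewrite !circA circgVK.
Qed.

Let sq_zetaD := aut_antihomD sq_zetaP.
Let sq_zetaM := aut_antihomM sq_zetaP.

Lemma sq_xi_eps x v :
  sq_xi x (sq_eps x v) = sq_zeta x (v.1, v.1) + (0, - v.1 + v.2).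
Proof.
rewrite sq_epsE sq_zetaE /sq_xi; apply: injective_projections => /=.
  by rewrite addr0 xiM xi_eps.
rewrite epsD -!epsM !circA circgV circ1g; congr (_ + _).
by rewrite circgK circVg eps1.
Qed.

Lemma sq_good1 x y v :
  sq_xi (x * y) (sq_eps (x * y) v) + sq_zeta y v
  = sq_zeta y (sq_xi x (sq_eps x v)) + sq_xi y (sq_eps y v).
Proof.
have -> : sq_zeta y v = sq_zeta y (v.1, v.1) + sq_zeta y (0, - v.1 + v.2).
  rewrite -sq_zetaD; congr (sq_zeta y _).
  by apply: injective_projections; rewrite /= ?addr0 // addrA subrr add0r.
rewrite !sq_xi_eps sq_zetaD sq_zetaM.
by rewrite [LHS]addrACA [RHS]addrACA; congr (_ + _); rewrite addrC.
Qed.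

Lemma sq_good2 x y v :
  sq_zeta (x^-1 * (x \circ y)) (sq_xi x v) = sq_xi x (sq_zeta y v).
Proof.
rewrite [x \circ y]sq_circE -!mulgA mulKg !sq_zetaE /sq_xi /=.
rewrite !mul1g !invg1 !lam1 !mulg1 !cinvM !cinvK.
set r := _ \circ x.1; have -> : cinv x.1 \circ x.2 = cinv r.
  by rewrite /r cinvM cinvK.
rewrite zeta_xi del_lam -epsM circVg eps1 -xiD.
by rewrite -!epsM -!xiM circKg circgVK.
Qed.

Definition sq_triplet : goodTriplet (square H) (I * I)%type :=
  GoodTriplet sq_xiP sq_zetaP sq_epsP sq_good1 sq_good2.

End SquareTriplet.

(* The quotient of Z by the elements of Z that lie in B; the inclusion of B   *)
(* in Z is not needed to form it.                                             *)

Section Cohomology.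
Variables (C : zmodType) (Z B : zmodClosed C).

Record cocycle := Cocycle { cochain : C; _ : cochain \in Z }.

HB.instance Definition _ := [isSub for cochain].
HB.instance Definition _ := [Choice of cocycle by <:].
HB.instance Definition _ := [SubChoice_isSubZmodule of cocycle by <:].

Definition coboundary : {pred cocycle} := [pred c | cochain c \in B].

Lemma coboundary_zmod_closed : GRing.zmod_closed coboundary.
Proof.
split; first by rewrite inE -[cochain]/val raddf0 rpred0.
by move=> x y; rewrite !inE -[cochain]/val raddfB; apply: rpredB.
Qed.

HB.instance Definition _ :=
  GRing.isZmodClosed.Build cocycle coboundary coboundary_zmod_closed.

Definition cohomology := Quotient.quot coboundary.

HB.instance Definition _ := GRing.Zmodule.on cohomology.

Definition cls (c : cocycle) : cohomology := \pi_(Quotient.quot coboundary)%qT c.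

End Cohomology.

Definition normalized1 (T : groupType) (J : zmodType) (c : T -> J) : Prop :=
  c 1 = 0.

Definition normalized2 (T : groupType) (J : zmodType) (c : T -> T -> J) : Prop :=
  (forall a, c a 1 = 0) /\ (forall a, c 1 a = 0).

Section RRBCohomology.
Variables (H : skewBraceType) (I : zmodType) (A : rrbModule H I).

(* quadruples (tau1, tau2, rho, chi) *)
Definition C2RRB : zmodType :=
  ((H -> H -> I) * (H -> H -> I) * (H -> H -> I) * (H -> I))%type.

Record Z2RRB_spec (t1 t2 rho : H -> H -> I) (chi : H -> I) : Prop :=
  Z2RRBSpec {
  _ : normalized2 t1;
  _ : normalized2 t2;
  _ : normalized2 rho;
  _ : normalized1 chi;
  _ : forall a1 a2 a3, t1 a2 a3 + t1 a1 (a2 * a3)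
      = t1 (a1 * a2) a3 + mu A a3 (t1 a1 a2);
  _ : forall b1 b2 b3, t2 b2 b3 + t2 b1 (b2 \circ b3)
      = t2 (b1 \circ b2) b3 + sigma A b3 (t2 b1 b2);
  _ : forall a b1 b2, rho (lam b2 a) b1 + nu A b1 (rho a b2)
      = rho a (b1 \circ b2) + nu A (b1 \circ b2) (mf A (t2 b1 b2) a);
  _ : forall a1 a2 b, rho (a1 * a2) b + nu A b (t1 a1 a2)
      = mu A (lam b a2) (rho a1 b) + rho a2 b + t1 (lam b a1) (lam b a2);
  _ : forall a1 a2,
      t2 a1 a2 + chi a2 - chi (a1 \circ a2) + sigma A a2 (chi a1)
      = nu A (cinv (a1 \circ a2))
          (rho a2 a1 + t1 a1 (lam a1 a2) + nu A a1 (mf A (chi a1) a2))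
}.

Record B2RRB_spec (t1 t2 rho : H -> H -> I) (chi : H -> I)
    (k1 k2 : H -> I) : Prop := B2RRBSpec {
  _ : normalized1 k1;
  _ : normalized1 k2;
  _ : forall a1 a2, t1 a1 a2 = - k1 (a1 * a2) + k1 a2 + mu A a2 (k1 a1);
  _ : forall b1 b2, t2 b1 b2 = - k2 (b1 \circ b2) + k2 b2 + sigma A b2 (k2 b1);
  _ : forall a b, rho a b = nu A b (mf A (k2 b) a + k1 a) - k1 (lam b a);
  _ : forall a, chi a = nu A (cinv a) (k1 a) - k2 a
}.

Definition Z2RRB : {pred C2RRB} :=
  fun c => let: (t1, t2, rho, chi) := c in `[< Z2RRB_spec t1 t2 rho chi >].

Definition B2RRB : {pred C2RRB} :=
  fun c => let: (t1, t2, rho, chi) := c in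
    `[< exists k1 k2, B2RRB_spec t1 t2 rho chi k1 k2 >].

Let nuB h := morphB (aut_homD (nuP A) h).
Let muB h := morphB (aut_antihomD (muP A) h).
Let sigmaB h := morphB (aut_antihomD (sigmaP A) h).
Let mfB h : {morph (mf A)^~ h : u w / u - w}.
Proof. by apply: morphB => u w; apply: mfD. Qed.
Let nu0 h := morph0 (aut_homD (nuP A) h).
Let mu0 h := morph0 (aut_antihomD (muP A) h).
Let sigma0 h := morph0 (aut_antihomD (sigmaP A) h).
Let mf0 h : mf A 0 h = 0.
Proof. by apply: (@morph0 I I ((mf A)^~ h)) => u w; apply: mfD. Qed.

Lemma Z2RRB_zmod_closed : GRing.zmod_closed Z2RRB.
Proof.
split.
  apply/asboolP; split=> // *;
    by rewrite ?(mf0, nu0, mu0, sigma0, addr0, subr0).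
move=> [[[t1 t2] rho] chi] [[[t1' t2'] rho'] chi'].
move=> /asboolP[[n1 n1'] [n2 n2'] [n3 n3'] n4 e1 e2 e3 e4 e5].
move=> /asboolP[[m1 m1'] [m2 m2'] [m3 m3'] m4 f1 f2 f3 f4 f5].
apply/asboolP; change (Z2RRB_spec
  (fun a b => t1 a b - t1' a b) (fun a b => t2 a b - t2' a b)
  (fun a b => rho a b - rho' a b) (fun a => chi a - chi' a)).
split=> /=.
- by split=> a; rewrite ?n1 ?n1' ?m1 ?m1' subr0.
- by split=> a; rewrite ?n2 ?n2' ?m2 ?m2' subr0.
- by split=> a; rewrite ?n3 ?n3' ?m3 ?m3' subr0.
- by rewrite /normalized1 n4 m4 subr0.
- by move=> a1 a2 a3; rewrite muB !subDD e1 f1.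
- by move=> a1 a2 a3; rewrite sigmaB !subDD e2 f2.
- by move=> a1 a2 a3; rewrite mfB !nuB !subDD e3 f3.
- by move=> a1 a2 a3; rewrite muB nuB !subDD e4 f4.
by move=> a1 a2; rewrite mfB sigmaB nuB subNN !subDD nuB e5 f5.
Qed.

Lemma B2RRB_zmod_closed : GRing.zmod_closed B2RRB.
Proof.
split.
  apply/asboolP; exists 0, 0; split=> // *;
    by rewrite ?(mf0, nu0, mu0, sigma0, oppr0, addr0, subr0).
move=> [[[t1 t2] rho] chi] [[[t1' t2'] rho'] chi'].
move=> /asboolP[k1 [k2 [n1 n2 e1 e2 e3 e4]]].
move=> /asboolP[k1' [k2' [m1 m2 f1 f2 f3 f4]]].
apply/asboolP; exists (fun a => k1 a - k1' a), (fun a => k2 a - k2' a).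
change (B2RRB_spec
  (fun a b => t1 a b - t1' a b) (fun a b => t2 a b - t2' a b)
  (fun a b => rho a b - rho' a b) (fun a => chi a - chi' a)
  (fun a => k1 a - k1' a) (fun a => k2 a - k2' a)).
split=> /=.
- by rewrite /normalized1 n1 m1 subr0.
- by rewrite /normalized1 n2 m2 subr0.
- by move=> a1 a2; rewrite muB subNN !subDD e1 f1.
- by move=> a1 a2; rewrite sigmaB subNN !subDD e2 f2.
- by move=> a1 a2; rewrite mfB subDD nuB subNN subDD e3 f3.
by move=> a1; rewrite nuB subNN subDD e4 f4.
Qed.

HB.instance Definition _ := GRing.isZmodClosed.Build C2RRB Z2RRB Z2RRB_zmod_closed.
HB.instance Definition _ := GRing.isZmodClosed.Build C2RRB B2RRB B2RRB_zmod_closed.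

Definition H2RRB : zmodType := cohomology Z2RRB B2RRB.

End RRBCohomology.

Section SBCohomology.
Variables (M : skewBraceType) (J : zmodType) (T : goodTriplet M J).

Definition C2SB : zmodType := ((M -> M -> J) * (M -> M -> J))%type.

Record Z2SB_spec (g p : M -> M -> J) : Prop := Z2SBSpec {
  _ : normalized2 g;
  _ : normalized2 p;
  _ : forall m1 m2 m3,
      g m2 m3 - g (m1 * m2) m3 + g m1 (m2 * m3) - zeta T m3 (g m1 m2) = 0;
  _ : forall m1 m2 m3,
      xi T m1 (p m2 m3) - p (m1 \circ m2) m3 + p m1 (m2 \circ m3)
      - xi T (m1 \circ m2 \circ m3)
          (eps T m3 (xi T (cinv (m1 \circ m2)) (p m1 m2))) = 0;
  _ : forall m1 m2 m3,
      xi T m1 (g m2 m3) + zeta T (m1 \circ m3) (g m1 m1^-1)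
      - zeta T (m1 \circ m3) (g (m1 \circ m2) m1^-1)
      - g ((m1 \circ m2) * m1^-1) (m1 \circ m3)
      - zeta T (m1^-1 * (m1 \circ m3)) (p m1 m2)
      + p m1 (m2 * m3) - p m1 m3 = 0
}.

Record B2SB_spec (g p : M -> M -> J) (theta : M -> J) : Prop := B2SBSpec {
  _ : normalized1 theta;
  _ : forall m1 m2,
      g m1 m2 = - theta (m1 * m2) + zeta T m2 (theta m1) + theta m2;
  _ : forall m1 m2, p m1 m2 = - theta (m1 \circ m2)
      + xi T (m1 \circ m2) (eps T m2 (xi T (cinv m1) (theta m1)))
      + xi T m1 (theta m2)
}.

Definition Z2SB : {pred C2SB} := fun c => let: (g, p) := c in
  `[< Z2SB_spec g p >].

Definition B2SB : {pred C2SB} := fun c => let: (g, p) := c in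
  `[< exists theta, B2SB_spec g p theta >].

Let xiB h := morphB (aut_homD (xiP T) h).
Let zetaB h := morphB (aut_antihomD (zetaP T) h).
Let epsB h := morphB (aut_antihomD (epsP T) h).
Let xi0 h := morph0 (aut_homD (xiP T) h).
Let zeta0 h := morph0 (aut_antihomD (zetaP T) h).
Let eps0 h := morph0 (aut_antihomD (epsP T) h).

Lemma Z2SB_zmod_closed : GRing.zmod_closed Z2SB.
Proof.
split.
  by apply/asboolP; split=> // *; rewrite ?(xi0, eps0, zeta0, addr0, subr0).
move=> [g p] [g' p'].
move=> /asboolP[[n1 n1'] [n2 n2'] e1 e2 e3].
move=> /asboolP[[m1 m1'] [m2 m2'] f1 f2 f3].
apply/asboolP; change (Z2SB_spec
  (fun a b => g a b - g' a b) (fun a b => p a b - p' a b)).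
split=> /=.
- by split=> a; rewrite ?n1 ?n1' ?m1 ?m1' subr0.
- by split=> a; rewrite ?n2 ?n2' ?m2 ?m2' subr0.
- by move=> a b c; rewrite zetaB !subNN !subDD e1 f1 subr0.
- by move=> a b c; rewrite !(xiB, epsB) !subNN !subDD e2 f2 subr0.
by move=> a b c; rewrite xiB !zetaB !subNN !subDD e3 f3 subr0.
Qed.

Lemma B2SB_zmod_closed : GRing.zmod_closed B2SB.
Proof.
split.
  apply/asboolP; exists 0; split=> // *;
    by rewrite ?(xi0, eps0, zeta0, oppr0, addr0).
move=> [g p] [g' p'].
move=> /asboolP[t [n1 e1 e2]] /asboolP[t' [m1 f1 f2]].
apply/asboolP; exists (fun a => t a - t' a); change (B2SB_spec
  (fun a b => g a b - g' a b) (fun a b => p a b - p' a b)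
  (fun a => t a - t' a)).
split=> /=.
- by rewrite /normalized1 n1 m1 subr0.
- by move=> a b; rewrite zetaB subNN !subDD e1 f1.
by move=> a b; rewrite !(xiB, epsB) subNN !subDD e2 f2.
Qed.

HB.instance Definition _ := GRing.isZmodClosed.Build C2SB Z2SB Z2SB_zmod_closed.
HB.instance Definition _ := GRing.isZmodClosed.Build C2SB B2SB B2SB_zmod_closed.

Definition H2SB : zmodType := cohomology Z2SB B2SB.

End SBCohomology.

Section RBCohomology.
Variables (H : skewBraceType) (I : zmodType) (A : rrbModule H I).
Implicit Types (x y : square H) (v w : I * I).

(* The Rota-Baxter operator (k, l) |-> (1, l^-1 k) on I * I. *)
Definition rbI v : I * I := (0, - v.2 + v.1).

Definition gamma x v : I * I :=
  (nu A (cinv x.2) (mu A x.1 v.1 + mf A v.2 x.1), sigma A x.2 v.2).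

Definition C2RB : zmodType :=
  ((square H -> square H -> I * I) * (square H -> I * I))%type.

Record Z2RB_spec (t : square H -> square H -> I * I) (r : square H -> I * I) :
    Prop := Z2RBSpec {
  _ : normalized2 t;
  _ : normalized1 r;
  _ : forall x1 x2 x3, t x2 x3 + t x1 (x2 * x3)
      = t (x1 * x2) x3 + gamma x3 (t x1 x2);
  _ : forall x1 x2, let R1 := rbR x1 in let R2 := rbR x2 in
      t R1 R2 + gamma R2 (r x1) + r x2
      = r (x1 \circ x2)
        + rbI (gamma R2 (gamma x2 (r x1) - r x1)
               + gamma (R1 * R2)
                   (t (x1 * R1) (x2 * R1^-1) + gamma (x2 * R1^-1) (t x1 R1)
                    + t x2 R1^-1 - t R1 R1^-1))
}.

Record B2RB_spec (t : square H -> square H -> I * I) (r : square H -> I * I)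
    (theta : square H -> I * I) : Prop := B2RBSpec {
  _ : normalized1 theta;
  _ : forall x1 x2,
      t x1 x2 = theta x2 - theta (x1 * x2) + gamma x2 (theta x1);
  _ : forall x, r x = rbI (gamma (rbR x) (theta x)) - theta (rbR x)
}.

Definition Z2RB : {pred C2RB} := fun c => let: (t, r) := c in
  `[< Z2RB_spec t r >].

Definition B2RB : {pred C2RB} := fun c => let: (t, r) := c in
  `[< exists theta, B2RB_spec t r theta >].

Lemma gammaD x : {morph gamma x : v w / v + w}.
Proof.
move=> v w; rewrite /gamma; apply: injective_projections => /=.
  by rewrite (aut_antihomD (muP A)) mfD addrACA; apply: (aut_homD (nuP A)).
by rewrite (aut_antihomD (sigmaP A)).
Qed.

Lemma rbID : {morph rbI : v w / v + w}.
Proof.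
move=> v w; rewrite /rbI; apply: injective_projections => /=.
  by rewrite addr0.
by rewrite opprD addrACA.
Qed.

Let gammaB x := morphB (gammaD x).
Let gamma0 x := morph0 (gammaD x).
Let rbIB := morphB rbID.
Let rbI0 := morph0 rbID.

Lemma Z2RB_zmod_closed : GRing.zmod_closed Z2RB.
Proof.
split.
  by apply/asboolP; split=> // *; rewrite ?(gamma0, rbI0, addr0, subr0).
move=> [t r] [t' r'].
move=> /asboolP[[n1 n1'] n2 e1 e2] /asboolP[[m1 m1'] m2 f1 f2].
apply/asboolP; change (Z2RB_spec
  (fun a b => t a b - t' a b) (fun a => r a - r' a)).
split=> /=.
- by split=> a; rewrite ?n1 ?n1' ?m1 ?m1' subr0.
- by rewrite /normalized1 n2 m2 subr0.
- by move=> a b c; rewrite gammaB !subDD e1 f1.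
move=> a b; rewrite (gammaB (rbR b) (r a)) (gammaB b (r a)).
rewrite (gammaB _ (t a _)) (subNN (r a)) (subNN (t _ _)) !subDD.
rewrite (gammaB (rbR b) (gamma _ _ - _)).
by rewrite (gammaB (rbR a * rbR b) (_ + _ - _)) subDD rbIB subDD e2 f2.
Qed.

Lemma B2RB_zmod_closed : GRing.zmod_closed B2RB.
Proof.
split.
  by apply/asboolP; exists 0; split=> // *; rewrite ?(gamma0, rbI0, addr0, subr0).
move=> [t r] [t' r'].
move=> /asboolP[k [n1 e1 e2]] /asboolP[k' [m1 f1 f2]].
apply/asboolP; exists (fun a => k a - k' a); change (B2RB_spec
  (fun a b => t a b - t' a b) (fun a => r a - r' a) (fun a => k a - k' a)).
split=> /=.
- by rewrite /normalized1 n1 m1 subr0.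
- by move=> a b; rewrite gammaB subNN !subDD e1 f1.
by move=> a; rewrite gammaB rbIB subNN subDD e2 f2.
Qed.

HB.instance Definition _ := GRing.isZmodClosed.Build C2RB Z2RB Z2RB_zmod_closed.
HB.instance Definition _ := GRing.isZmodClosed.Build C2RB B2RB B2RB_zmod_closed.

Definition H2RB : zmodType := cohomology Z2RB B2RB.

End RBCohomology.

Section RRBMaps.
Variables (H : skewBraceType) (I : zmodType) (A : rrbModule H I).

Definition psi (c : C2RRB H I) : C2SB H I :=
  let: (t1, t2, rho, chi) := c in
  (t1, fun h1 h2 =>
     t1 h1 (lam h1 h2) + rho h2 h1 + nu A h1 (mf A (chi h1) h2)).

Definition omegaRB (c : C2RRB H I) : C2RB H I :=
  let: (t1, t2, rho, chi) := c in
  (fun x1 x2 => let: (h1, g1) := x1 in let: (h2, g2) := x2 in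
     (nu A (cinv (g1 \circ g2)) (t1 h1 (lam g1 h2) + rho h2 g1), t2 g1 g2),
   fun x => let: (h, g) := x in (0, - t2 g (cinv g \circ h) + chi h)).

Definition psiT (c : C2RB H I) : C2SB (square H) (I * I)%type :=
  let: (t, r) := c in
  (t, fun x1 x2 => let R1 := rbR x1 in
     t x1 (R1 * x2 * R1^-1) + t (R1 * x2) R1^-1
     + gamma A R1^-1 (t R1 x2 + gamma A x2 (r x1) - r x1) - t R1 R1^-1).

End RRBMaps.

Section SBMap.
Variables (H : skewBraceType) (I : zmodType) (T : goodTriplet H I).

Definition omegaSB (c : C2SB H I) : C2SB (square H) (I * I)%type :=
  let: (t1, t2) := c in
  (fun x1 x2 => let: (h1, g1) := x1 in let: (h2, g2) := x2 in
     (xi T (cinv (g1 \circ g2))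
        (t1 h1 (lam g1 h2) + t1 g1^-1 (g1 \circ h2)
         + zeta T (g1 \circ h2) (- t1 g1 g1^-1) + t2 g1 h2),
      xi T (cinv (g1 \circ g2)) (t2 g1 g2)),
   fun x1 x2 => let: (h1, g1) := x1 in let: (h2, g2) := x2 in
     let u := h1 \circ g2 \circ cinv h1 \circ g1 in
     (xi T (cinv u) (t2 h1 h2),
      xi T (cinv u) (t2 (h1 \circ g2) (cinv h1 \circ g1))
      + eps T (cinv h1 \circ g1) (xi T (cinv (h1 \circ g2)) (t2 h1 g2))
      - xi T (cinv g1) (t2 h1 (cinv h1 \circ g1)))).

End SBMap.

(* [F] is the map [c] |-> [phi c] on cohomology classes: phi sends cocycles   *)
(* to cocycles, and F maps the class of c to that of phi c. As every class is *)
(* the class of some cocycle, phi determines F.                               *)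
Definition induced_by (C C' : zmodType) (Z B : zmodClosed C)
    (Z' B' : zmodClosed C') (phi : C -> C')
    (F : cohomology Z B -> cohomology Z' B') : Prop :=
  forall c : cocycle Z, exists2 c' : cocycle Z',
    cochain c' = phi (cochain c) & F (cls B c) = cls B' c'.

(* Main.v *)
From HB Require Import structures.
Require Import Defs.
From mathcomp Require Import all_boot all_algebra.
From mathcomp Require Import generic_quotient ring_quotient boolp functions.

(** A 2-cocycle is what one reads off an extension after choosing a section,
so all four maps are understood on extensions with sections, and few cocycle
identities have to be checked by hand.

Let [E] be a skew brace extension of [H] by [I], with inclusion [i] and
section [s]. The relations between [i], [s] and the two operations of [E]
([sbSection]) involve a pair of cochains [(g, p)]; associativity and the brace
law in [E] then force [(g, p)] to be a cocycle ([sb_mem_Z]), and every cocycle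
arises in this way from an explicit skew brace [sbExt] ([ext_section]). Two
sections of one extension give cohomologous cocycles ([sb_sub_mem_B]). In the
same way a group with a Rota-Baxter operator and a section ([rbSection]) gives
a Rota-Baxter cocycle ([rb_mem_Z], [ext_rbSection]); the operator turns that
group into a skew brace, whose cocycle is given by [psiT] ([rb_sbSection]).

The square of [E] is an extension of the square of [H], with the section
[(h, g) |-> (s h, s g)], whose cocycle is given by [omegaSB] ([sq_section]).
Hence [omegaSB] preserves cocycles. It also preserves coboundaries: if
[(g, p)] is a coboundary then [E] has another section with zero cocycle, and
the two sections of [E] give two sections of its square. The same argument
works for [psiT].

For [psi] and for the effect of [omegaRB] on coboundaries, short direct
computations suffice ([psi_Z], [psi_B], [omegaRB_B]).

Now let [c = (t1, t2, rho, chi)] be a relative Rota-Baxter cocycle, so that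
[psi c] is a skew brace cocycle. Take for [E] its extension, and put
[s2 g = s g \circ i (- chi g)]. This is the section of the multiplicative
group whose cocycle is [t2], and the pair [(s, s2)] is a section of the square
of [E], equipped with its operator [rbR], whose Rota-Baxter cocycle is
[omegaRB c] ([omegaRB_section]). So the skew brace cocycle of the section
[(s, s2)] is [psiT (omegaRB c)], while that of [(s, s)] is [omegaSB (psi c)].
These are two sections of the same extension, so the
cocycles are cohomologous, by the cochain [(h, g) |-> (0, - chi g)]
([psiT_omegaRB]). *)

Set Implicit Arguments.
Unset Strict Implicit.
Unset Printing Implicit Defensive.

Import GRing.Theory.

Local Open Scope ring_scope.
Local Open Scope group_scope.

(** * Identities in abelian groups *)

(** Formal sums over the entries of an environment. Two of them with the same
integer coefficients have the same value in every abelian group; the tactic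
[abel] below decides such identities. *)
Inductive abexp :=
  AbVar of nat | AbZero | AbAdd of abexp & abexp | AbOpp of abexp.

Fixpoint abcoef (e : abexp) (j : nat) : int :=
  match e with
  | AbVar k => (j == k)%:Z
  | AbZero => 0
  | AbAdd e1 e2 => abcoef e1 j + abcoef e2 j
  | AbOpp e1 => - abcoef e1 j
  end.

Section AbelianReflection.
Variable V : zmodType.
Implicit Types (env : seq V) (e : abexp).

Fixpoint abeval env e : V :=
  match e with
  | AbVar j => env`_j
  | AbZero => 0
  | AbAdd e1 e2 => abeval env e1 + abeval env e2
  | AbOpp e1 => - abeval env e1
  end.

Lemma abeval_coef env e :
  abeval env e = \sum_(j < size env) env`_j *~ abcoef e j.
Proof.
elim: e => [k||e1 IH1 e2 IH2|e1 IH] /=.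
- have [ltk|lek] := ltnP k (size env).
    rewrite (bigD1 (Ordinal ltk)) //= eqxx mulr1z big1 ?addr0 // => j.
    by rewrite -val_eqE /= => /negPf ->.
  rewrite nth_default // big1 // => j _.
  by rewrite (ltn_eqF (leq_trans (ltn_ord j) lek)).
- by rewrite big1 // => j _; rewrite mulr0z.
- by rewrite IH1 IH2 -big_split; apply: eq_bigr => j _; rewrite mulrzDr.
by rewrite IH -sumrN; apply: eq_bigr => j _; rewrite mulrNz.
Qed.

Lemma abeval_eq env e1 e2 :
  all (fun j => abcoef e1 j == abcoef e2 j) (iota 0 (size env)) ->
  abeval env e1 = abeval env e2.
Proof.
move=> /allP eq12; rewrite !abeval_coef; apply: eq_bigr => j _.
by rewrite (eqP (eq12 j _)) // mem_iota ltn_ord.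
Qed.

End AbelianReflection.

(** Atoms are compared up to conversion: the same group operation may be
reached through different chains of structures. *)
Ltac ab_index x env :=
  match env with
  | ?y :: _ => let _ := constr:(erefl x : x = y) in constr:(0%N)
  | _ :: ?env' => let n := ab_index x env' in constr:(S n)
  end.

Ltac ab_insert x env :=
  match env with
  | _ => let _ := ab_index x env in env
  | _ => constr:(x :: env)
  end.

Ltac ab_atoms t env :=
  lazymatch t with
  | GRing.add ?a ?b => let env' := ab_atoms a env in ab_atoms b env'
  | GRing.opp ?a => ab_atoms a env
  | GRing.zero => env
  | _ => ab_insert t env
  end.

Ltac ab_reify t env :=
  lazymatch t with
  | GRing.add ?a ?b =>
      let e1 := ab_reify a env in let e2 := ab_reify b env in
      constr:(AbAdd e1 e2)
  | GRing.opp ?a => let e := ab_reify a env in constr:(AbOpp e)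
  | GRing.zero => constr:(AbZero)
  | _ => let n := ab_index t env in constr:(AbVar n)
  end.

Ltac abel :=
  lazymatch goal with
  | |- @eq ?V ?a ?b =>
      let env0 := ab_atoms a (@nil V) in
      let env := ab_atoms b env0 in
      let e1 := ab_reify a env in
      let e2 := ab_reify b env in
      exact: (@abeval_eq _ env e1 e2 isT)
  end.

(** Subtracts the hypothesis [l = r] from the goal, so that [abel] can finish
a proof by linear combination. *)
Lemma add_eqn (V : zmodType) (a b l r : V) : l = r -> a + r = b + l -> a = b.
Proof. by move=> -> /addIr. Qed.

(** * Maps induced on cohomology *)

Section CohomologyClasses.
Variables (C : zmodType) (Z B : zmodClosed C).

Lemma cls_eq (c d : cocycle Z) :
  (cls B c == cls B d) = (cochain c - cochain d \in B).
Proof. by rewrite -Quotient.idealrBE. Qed.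

Lemma cls_surj (x : cohomology Z B) : exists c, x = cls B c.
Proof. by exists (repr x); rewrite /cls reprK. Qed.

End CohomologyClasses.

Section InducedMap.
Variables (C C' : zmodType) (Z B : zmodClosed C) (Z' B' : zmodClosed C').

Variable phi : C -> C'.
Hypothesis phiB : {morph phi : c d / c - d}.
Hypothesis phiZ : forall c, c \in Z -> phi c \in Z'.
Hypothesis phiBZ : forall c, c \in Z -> c \in B -> phi c \in B'.

Let push (c : cocycle Z) : cocycle Z' := Cocycle (phiZ (valP c)).

Definition coh_map (x : cohomology Z B) : cohomology Z' B' :=
  cls B' (push (repr x)).

Lemma coh_map_cls c : coh_map (cls B c) = cls B' (push c).
Proof.
apply/eqP; rewrite cls_eq /= -phiB; apply: phiBZ.
  exact: rpredB (valP _) (valP _).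
by rewrite -cls_eq /cls reprK.
Qed.

Lemma coh_map_is_zmod_morphism : zmod_morphism coh_map.
Proof.
move=> x y; have [[c ->] [d ->]] := (cls_surj x, cls_surj y).
have clsB (D : zmodType) (Y W : zmodClosed D) (u v : cocycle Y) :
  cls W u - cls W v = cls W (u - v) by rewrite /cls raddfB.
rewrite clsB !coh_map_cls clsB; congr cls; apply/val_inj; exact: phiB.
Qed.

HB.instance Definition _ := GRing.isZmodMorphism.Build
  (cohomology Z B) (cohomology Z' B') coh_map coh_map_is_zmod_morphism.

Lemma induced_map : exists F : {additive cohomology Z B -> cohomology Z' B'},
  induced_by phi F.
Proof. by exists coh_map => c; exists (push c); last exact: coh_map_cls. Qed.

End InducedMap.

(** * Group extensions with abelian kernel *)

Record groupCocycle (G : groupType) (J : zmodType) := GroupCocycle {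
  gact : G -> J -> J;
  gcoc : G -> G -> J;
  gactP : aut_antihom *%g 1 gact;
  gcoc_norm : normalized2 gcoc;
  gcocP : forall x y z,
    gcoc y z + gcoc x (y * z) = gcoc (x * y) z + gact z (gcoc x y)
}.

(** The pair [(m, v)] stands for [s m * i v], where [s] is the section and [i]
the inclusion of the kernel; the action is on the right, as it is an
anti-homomorphism. *)
Definition ext (G : groupType) (J : zmodType) (c : groupCocycle G J) : Type :=
  (G * J)%type.

HB.instance Definition _ G J (c : groupCocycle G J) := Choice.on (ext c).

Section GroupExtension.
Variables (G : groupType) (J : zmodType) (c : groupCocycle G J).
Implicit Types (x y z : ext c).

Definition ext_one : ext c := (1, 0).

Definition ext_mul x y : ext c :=
  (x.1 * y.1, gcoc c x.1 y.1 + gact c y.1 x.2 + y.2).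

Definition ext_inv x : ext c :=
  (x.1^-1, gact c x.1^-1 (- x.2 - gcoc c x.1^-1 x.1)).

Let actD := aut_antihomD (gactP c).
Let act1 := aut_antihom1 (gactP c).
Let actM := aut_antihomM (gactP c).
Let act0 m := morph0 (actD m).

Lemma ext_mulA : associative ext_mul.
Proof.
move=> x y z; rewrite /ext_mul /=; apply: injective_projections => /=.
  exact: mulgA.
rewrite !actD actM; apply: (add_eqn (gcocP c x.1 y.1 z.1)); abel.
Qed.

Lemma ext_mul1 : left_id ext_one ext_mul.
Proof.
case=> m v; rewrite /ext_mul /= mul1g act0.
by case: (gcoc_norm c) => _ ->; rewrite !add0r.
Qed.

Lemma ext_mulr1 : right_id ext_one ext_mul.
Proof.
case=> m v; rewrite /ext_mul /= mulg1 act1.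
by case: (gcoc_norm c) => -> _; rewrite add0r addr0.
Qed.

Lemma ext_mulV : left_inverse ext_one ext_inv ext_mul.
Proof.
case=> m v; rewrite /ext_mul /ext_inv /= mulVg -actM mulVg act1; congr (_, _).
abel.
Qed.

Lemma ext_mulVr : right_inverse ext_one ext_inv ext_mul.
Proof.
case=> m v; rewrite /ext_mul /ext_inv /= mulgV; congr (_, _).
have := gcocP c m m^-1 m; have [gr gl] := gcoc_norm c.
rewrite mulVg mulgV gr gl addr0 add0r => ->.
by rewrite (morphB (actD _)) (morphN (actD _)) -actM mulgV act1; abel.
Qed.

HB.instance Definition _ := isGroup.Build (ext c)
  ext_mulA ext_mul1 ext_mulr1 ext_mulV ext_mulVr.

Lemma ext_mulE x y : x * y = (x.1 * y.1, gcoc c x.1 y.1 + gact c y.1 x.2 + y.2).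
Proof. by []. Qed.

Lemma ext_invE x :
  x^-1 = (x.1^-1, - gcoc c x.1 x.1^-1 - gact c x.1^-1 x.2).
Proof.
apply: (mulgI x); rewrite mulgV ext_mulE /= mulgV; congr (_, _); abel.
Qed.

End GroupExtension.

(** * Sections of skew brace extensions *)

(** The multiplicative operation [cE] is a parameter because the same group
carries it in two forms: as a field of a skew brace, and as the operation
built from a Rota-Baxter operator. *)
Record sbSection (M : skewBraceType) (J : zmodType) (T : goodTriplet M J)
    (E : groupType) (cE : E -> E -> E) (i : J -> E) (s : M -> E)
    (g p : M -> M -> J) : Prop := SbSection {
  sb_circA : associative cE;
  sb_brace : forall a b c, cE a (b * c) = cE a b * a^-1 * cE a c;
  sb_iD : {morph i : y z / y + z >-> y * z};
  sb_i_inj : injective i;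
  sb_s1 : s 1 = 1;
  sb_mul : forall m n, s m * s n = s (m * n) * i (g m n);
  sb_circ : forall m n, cE (s m) (s n) = s (m \circ n) * i (p m n);
  sb_conj : forall y m, i y * s m = s m * i (zeta T m y);
  sb_lam : forall m y, cE (s m) (i y) = s m * i (xi T m y);
  sb_cconj : forall y m, cE (i y) (s m) = cE (s m) (i (eps T m y));
  sb_triv : forall y z, cE (i y) (i z) = i (y + z)
}.

Section SbSectionTheory.
Variables (M : skewBraceType) (J : zmodType) (T : goodTriplet M J).
Variables (E : groupType) (cE : E -> E -> E) (i : J -> E).
Implicit Types (s : M -> E) (g p : M -> M -> J) (theta : M -> J).

Let xiD := aut_homD (xiP T).
Let xi1 := aut_hom1 (xiP T).
Let xiM := aut_homM (xiP T).
Let zetaD := aut_antihomD (zetaP T).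
Let zetaM := aut_antihomM (zetaP T).
Let epsD := aut_antihomD (epsP T).

Lemma xi_cinvK m y : xi T (cinv m) (xi T m y) = y.
Proof. by rewrite -xiM circVg xi1. Qed.

Lemma xiK_cinv m y : xi T m (xi T (cinv m) y) = y.
Proof. by rewrite -xiM circgV xi1. Qed.

Section Theory.
Variables (s : M -> E) (g p : M -> M -> J).
Hypothesis S : sbSection T cE i s g p.

Let cEA := sb_circA S.
Let iD := sb_iD S.
Let i_inj := sb_i_inj S.
Let s1 := sb_s1 S.

Lemma sb_i0 : i 0 = 1.
Proof. by apply: (mulgI (i 0)); rewrite -iD addr0 mulg1. Qed.

Lemma sb_iN y : i (- y) = (i y)^-1.
Proof. by apply: (mulgI (i y)); rewrite -iD subrr mulgV sb_i0. Qed.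

Lemma sb_mulE m n y z :
  s m * i y * (s n * i z) = s (m * n) * i (g m n + zeta T n y + z).
Proof.
by rewrite mulgA -(mulgA (s m)) (sb_conj S) mulgA (sb_mul S) !iD !mulgA.
Qed.

Lemma sb_circ_i m y : s m * i y = cE (s m) (i (xi T (cinv m) y)).
Proof. by rewrite (sb_lam S) xiK_cinv. Qed.

(** The kernel elements are first moved to the right inside the multiplicative
group, where [s m * i y] reads [s m \circ i (xi_m^-1 y)]. This is the source
of the factor [xi \o eps \o xi^-1] in the cocycle and coboundary conditions.
*)
Lemma sb_circE m n y z : cE (s m * i y) (s n * i z)
  = s (m \circ n) * i (p m n
      + xi T (m \circ n) (eps T n (xi T (cinv m) y)) + xi T m z).
Proof.
rewrite !sb_circ_i -cEA (cEA (i _) (s n)) (sb_cconj S) !cEA (sb_circ S).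
rewrite sb_circ_i -!cEA !(sb_triv S); congr (cE _ (i _)).
rewrite !xiD !cinvM !xiM !xi_cinvK; abel.
Qed.

Lemma sb_invE m y :
  (s m * i y)^-1 = s m^-1 * i (- g m m^-1 - zeta T m^-1 y).
Proof.
apply: (mulgI (s m * i y)); rewrite sb_mulE !mulgV s1 mul1g -sb_i0.
by congr i; abel.
Qed.

(** Each identity is a law of [E] on [s m1], [s m2], [s m3], with both sides
in the normal form [s m * i y]. *)
Lemma sbZ : Z2SB_spec T g p.
Proof.
have cancel m y z : s m * i y = s m * i z -> y = z by move/mulgI/i_inj.
have g1 m : g m 1 = 0.
  by apply: (cancel m); have := sb_mul S m 1; rewrite sb_i0 s1 !mulg1.
have gr1 m : g 1 m = 0.
  by apply: (cancel m); have := sb_mul S 1 m; rewrite sb_i0 s1 !mul1g mulg1.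
have circ1 m : cE (s m) 1 = s m.
  by rewrite -sb_i0 (sb_lam S) (morph0 (xiD _)) sb_i0 mulg1.
have cirr1 m : cE 1 (s m) = s m.
  by rewrite -{1}sb_i0 (sb_cconj S) (morph0 (epsD _)) sb_i0.
split.
- by split.
- split=> m; apply: (cancel m).
    by have := sb_circ S m 1; rewrite sb_i0 s1 circg1 mulg1 circ1.
  by have := sb_circ S 1 m; rewrite sb_i0 s1 circ1g mulg1 cirr1.
- move=> m1 m2 m3.
  have := mulgA (s m1) (s m2) (s m3).
  rewrite -[s m1]mulg1 -[s m2]mulg1 -[s m3]mulg1 -sb_i0 !sb_mulE !mulgA.
  move/cancel => e; apply: (add_eqn e).
  rewrite !zetaD !(morph0 (zetaD _)); abel.
- move=> m1 m2 m3.
  have := cEA (s m1) (s m2) (s m3).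
  rewrite -[s m1]mulg1 -[s m2]mulg1 -[s m3]mulg1 -sb_i0 !sb_circE !circA.
  move/cancel => e; apply: (add_eqn e).
  rewrite !(xiD, epsD, morph0 (xiD _), morph0 (epsD _)); abel.
move=> m1 m2 m3.
have := sb_brace S (s m1) (s m2) (s m3).
rewrite -[s m1]mulg1 -[s m2]mulg1 -[s m3]mulg1 -sb_i0.
rewrite sb_mulE !sb_circE sb_invE !sb_mulE circ_brace.
move/cancel => e; apply: (add_eqn e); rewrite zetaM.
rewrite !(xiD, epsD, zetaD, morph0 (xiD _), morph0 (epsD _), morph0 (zetaD _)).
rewrite !(morphN (zetaD _), morph0 (zetaD _)); abel.
Qed.

(** Twisting the section by [theta] adds the coboundary of [theta] to the
cocycle. *)
Lemma sb_shift (theta : M -> J) : theta 1 = 0 ->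
  sbSection T cE i (fun m => s m * i (theta m))
    (fun m n => g m n + (- theta (m * n) + zeta T n (theta m) + theta n))
    (fun m n => p m n + (- theta (m \circ n)
      + xi T (m \circ n) (eps T n (xi T (cinv m) (theta m)))
      + xi T m (theta n))).
Proof.
move=> theta1; split; try by [exact: sb_circA S | exact: sb_brace S
  | exact: iD | exact: i_inj | exact: sb_triv S].
- by rewrite s1 theta1 sb_i0 mulg1.
- by move=> m n; rewrite sb_mulE -mulgA -iD; congr (_ * i _); abel.
- by move=> m n; rewrite sb_circE -mulgA -iD; congr (_ * i _); abel.
- by move=> y m; rewrite mulgA (sb_conj S) -!mulgA -!iD addrC.
- move=> m y; rewrite [in LHS]sb_circ_i -cEA (sb_triv S) (sb_lam S) xiD.
  by rewrite xiK_cinv iD mulgA.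
move=> y m; rewrite !sb_circ_i cEA (sb_cconj S) -!cEA !(sb_triv S).
by rewrite addrC.
Qed.

End Theory.

Lemma eq_sbSection s g g' p p' : sbSection T cE i s g p ->
  (forall m n, g m n = g' m n) -> (forall m n, p m n = p' m n) ->
  sbSection T cE i s g' p'.
Proof.
move=> S eg ep.
have <- : g = g' by apply/funext => m; apply/funext => n.
by have <- : p = p' by apply/funext => m; apply/funext => n.
Qed.

Lemma sb_mem_Z s (c : C2SB M J) : sbSection T cE i s c.1 c.2 -> c \in Z2SB T.
Proof. by case: c => g p /sbZ Zc; apply/asboolP. Qed.

Lemma sb_sub_mem_B s s' (c c' : C2SB M J) theta : theta 1 = 0 ->
  sbSection T cE i s c.1 c.2 -> sbSection T cE i s' c'.1 c'.2 ->
  (forall m, s' m = s m * i (theta m)) -> c' - c \in B2SB T.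
Proof.
case: c c' => g p [g' p'] /= theta1 S S' s'E; have St := sb_shift S theta1.
rewrite -[_ - _]/(g' - g, p' - p); apply/asboolP; exists theta.
split=> // m n; rewrite !fctE.
  have := sb_mul S' m n; rewrite !s'E (sb_mul St) => /mulgI/(sb_i_inj S) <-.
  by rewrite addrC addKr.
have := sb_circ S' m n; rewrite !s'E (sb_circ St) => /mulgI/(sb_i_inj S) <-.
by rewrite addrC addKr.
Qed.

(** An extension whose cocycle is a coboundary splits: the twisted section is
a homomorphism for both operations. *)
Lemma sb_untwist s g p theta :
  sbSection T cE i s g p -> B2SB_spec T g p theta ->
  sbSection T cE i (fun m => s m * i (- theta m))
    (fun _ _ => 0) (fun _ _ => 0).
Proof.
move=> S [theta1 gE pE].
have theta'1 : (fun m => - theta m) 1 = 0 by rewrite /= theta1 oppr0.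
apply: (eq_sbSection (sb_shift S theta'1)) => m n.
  by rewrite gE (morphN (zetaD _)); abel.
by rewrite pE !(morphN (xiD _), morphN (epsD _)); abel.
Qed.

End SbSectionTheory.

(** * The skew brace extension of a cocycle *)

Definition circGroup (M : skewBraceType) : Type := M.

HB.instance Definition _ (M : skewBraceType) := Choice.on (circGroup M).
HB.instance Definition _ (M : skewBraceType) := isGroup.Build (circGroup M)
  (@circA M) (@circ1g M) (@circg1 M) (@circVg M) (@circgV M).

Section BraceExtension.
Variables (M : skewBraceType) (J : zmodType) (T : goodTriplet M J).
Variable c : cocycle (Z2SB T).

Let xiD := aut_homD (xiP T).
Let xi1 := aut_hom1 (xiP T).
Let xiM := aut_homM (xiP T).
Let zetaD := aut_antihomD (zetaP T).
Let zeta1 := aut_antihom1 (zetaP T).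
Let zetaM := aut_antihomM (zetaP T).
Let epsD := aut_antihomD (epsP T).
Let eps1 := aut_antihom1 (epsP T).
Let xi0 h := morph0 (xiD h).
Let zeta0 h := morph0 (zetaD h).
Let eps0 h := morph0 (epsD h).

Let g := (cochain c).1.
Let p := (cochain c).2.

Lemma cocycle_spec : Z2SB_spec T g p.
Proof. by rewrite /g /p; case: c => -[? ?] /= /asboolP. Qed.

Lemma add_norm : normalized2 g. Proof. by case: cocycle_spec. Qed.

Lemma add_cocycle m1 m2 m3 :
  g m2 m3 + g m1 (m2 * m3) = g (m1 * m2) m3 + zeta T m3 (g m1 m2).
Proof.
case: cocycle_spec => _ _ /(_ m1 m2 m3) e _ _.
by apply: (add_eqn e); abel.
Qed.

Definition add_gcoc : groupCocycle M J :=
  GroupCocycle (zetaP T) add_norm add_cocycle.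

Let q (m n : M) := xi T (cinv (m \circ n)) (p m n).

Lemma circ_norm : normalized2 (q : circGroup M -> circGroup M -> J).
Proof.
case: cocycle_spec => _ [pr pl] _ _ _.
by split=> m; rewrite /q ?pr ?pl xi0.
Qed.

Lemma circ_cocycle m1 m2 m3 :
  q m2 m3 + q m1 (m2 \circ m3) = q (m1 \circ m2) m3 + eps T m3 (q m1 m2).
Proof.
case: cocycle_spec => _ _ _ /(_ m1 m2 m3) e _.
have {e} := congr1 (xi T (cinv (m1 \circ m2 \circ m3))) e.
rewrite (morphB (xiD _)) !xiD (morphN (xiD _)) xi0 xi_cinvK => e.
apply: (add_eqn e); rewrite /q !circA !cinvM -xiM !circA circgVK; abel.
Qed.

(** In the multiplicative group the natural normal form is [s m \circ i y],
for which the cocycle is [q] and the action is [eps]; the second condition on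
[p] is the usual cocycle condition for [q]. *)
Definition circ_gcoc : groupCocycle (circGroup M) J :=
  @GroupCocycle (circGroup M) J (eps T) q (epsP T) circ_norm circ_cocycle.

Definition sbExt : Type := ext add_gcoc.
HB.instance Definition _ := Group.on sbExt.
Implicit Types x y z : sbExt.

(** Passage between [s m * i y] and [s m \circ i y]. Defining the
multiplicative operation by transport along it makes its group laws automatic.
*)
Let to_circ x : ext circ_gcoc := (x.1, xi T (cinv x.1) x.2).
Let of_circ (x : ext circ_gcoc) : sbExt := (x.1, xi T x.1 x.2).

Lemma to_circK : cancel to_circ of_circ.
Proof. by case=> m y; rewrite /of_circ /= xiK_cinv. Qed.

Lemma of_circK : cancel of_circ to_circ.
Proof. by case=> m y; rewrite /to_circ /= xi_cinvK. Qed.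

Definition ext_circ x y : sbExt := of_circ (to_circ x * to_circ y).
Definition ext_cone : sbExt := of_circ 1.
Definition ext_cinv x : sbExt := of_circ (to_circ x)^-1.

Lemma ext_circE x y : ext_circ x y = (x.1 \circ y.1,
  p x.1 y.1 + xi T (x.1 \circ y.1) (eps T y.1 (xi T (cinv x.1) x.2))
  + xi T x.1 y.2).
Proof.
apply: injective_projections => //=; rewrite !xiD /q xiK_cinv.
by rewrite (xiM x.1 y.1 (xi T _ _)) xiK_cinv.
Qed.

Lemma ext_circA : associative ext_circ.
Proof. by move=> x y z; rewrite /ext_circ !of_circK mulgA. Qed.

Lemma ext_circ1 : left_id ext_cone ext_circ.
Proof. by move=> x; rewrite /ext_circ !of_circK mul1g to_circK. Qed.

Lemma ext_circr1 : right_id ext_cone ext_circ.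
Proof. by move=> x; rewrite /ext_circ !of_circK mulg1 to_circK. Qed.

Lemma ext_circV : left_inverse ext_cone ext_cinv ext_circ.
Proof. by move=> x; rewrite /ext_circ !of_circK mulVg. Qed.

Lemma ext_circrV : right_inverse ext_cone ext_cinv ext_circ.
Proof. by move=> x; rewrite /ext_circ !of_circK mulgV. Qed.

Lemma sbExt_mulE x y :
  x * y = (x.1 * y.1, g x.1 y.1 + zeta T y.1 x.2 + y.2).
Proof. by []. Qed.

Lemma sbExt_invE x : x^-1 = (x.1^-1, - g x.1 x.1^-1 - zeta T x.1^-1 x.2).
Proof. exact: ext_invE. Qed.

Lemma ext_circ_brace x y z :
  ext_circ x (y * z) = ext_circ x y * x^-1 * ext_circ x z.
Proof.
rewrite !ext_circE !sbExt_mulE sbExt_invE /=.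
apply: injective_projections => /=.
  exact: circ_brace.
case: x y z => [m1 y1] [m2 y2] [m3 y3] /=.
case: cocycle_spec => _ _ _ _ /(_ m1 m2 m3) e.
(* Over [w], both sides lie in the image of [xi T m1], where [good1] applies. *)
set w := xi T (cinv m1) y1; have -> : y1 = xi T m1 w by rewrite xiK_cinv.
have e' := congr1 (xi T m1) (good1 T m2 m3 w).
apply: (add_eqn e); apply: (add_eqn e'); rewrite !xiD !(xiM m1).
rewrite !(zetaD, morphN (zetaD _), morphB (zetaD _)) -!zetaM.
rewrite -!(good2 T m1 m3); abel.
Qed.

HB.instance Definition _ := Group_isSkewBrace.Build sbExt
  ext_circA ext_circ1 ext_circr1 ext_circV ext_circrV ext_circ_brace.

Definition ext_i (y : J) : sbExt := (1, y).
Definition ext_s (m : M) : sbExt := (m, 0).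

Lemma ext_section : sbSection T (@circ sbExt) ext_i ext_s g p.
Proof.
have [gr gl] := add_norm; case: cocycle_spec => _ [pr pl] _ _ _.
split.
- exact: circA.
- exact: circ_brace.
- by move=> y z; rewrite sbExt_mulE /= mulg1 gr zeta1 add0r.
- by move=> y z [].
- by [].
- by move=> m n; rewrite !sbExt_mulE /= mulg1 gr !(zeta1, zeta0, add0r, addr0).
- move=> m n; rewrite sbExt_mulE [LHS]ext_circE /= mulg1 gr zeta1.
  by rewrite !(xi0, eps0) !addr0 add0r.
- move=> y m; rewrite !sbExt_mulE /= mulg1 mul1g gr gl.
  by rewrite !(zeta1, zeta0, addr0, add0r).
- move=> m y; rewrite sbExt_mulE [LHS]ext_circE /= mulg1 circg1 gr pr zeta1.
  by rewrite !(xi0, eps0).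
- move=> y m; rewrite [LHS]ext_circE [RHS]ext_circE /= circ1g circg1 pl pr.
  by rewrite cinv1 !(xi0, eps0, xi1) !addr0 !add0r.
move=> y z; rewrite [LHS]ext_circE /= circ1g pl cinv1 !xi1 eps1 add0r.
by [].
Qed.

End BraceExtension.

(** * The square of an extension *)

Section SquareSection.
Variables (H : skewBraceType) (I : zmodType) (T : goodTriplet H I).
Variables (E : skewBraceType) (i : I -> E) (s : H -> E) (g p : H -> H -> I).
Hypothesis S : sbSection T (@circ E) i s g p.
Implicit Types (x : square H) (v w : I * I).

Let xiM := aut_homM (xiP T).
Let zetaD := aut_antihomD (zetaP T).
Let epsD := aut_antihomD (epsP T).
Let eps1 := aut_antihom1 (epsP T).
Let epsM := aut_antihomM (epsP T).
Let iD := sb_iD S.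

Lemma sb_circ_circ m n :
  s m \circ s n = s (m \circ n) \circ i (xi T (cinv (m \circ n)) (p m n)).
Proof. by rewrite (sb_circ S) (sb_circ_i S). Qed.

Lemma sb_cinv_i y : cinv (i y) = i (- y).
Proof.
by rewrite -[RHS](circKg (i y)) (sb_triv S) subrr (sb_i0 S) circg1.
Qed.

Lemma sb_cinv_circ h m : cinv (s h) \circ s m
  = s (cinv h \circ m) \circ i (- xi T (cinv m) (p h (cinv h \circ m))).
Proof.
rewrite -[RHS](circKg (s h)) (circA (s h)) sb_circ_circ circVKg -circA.
by rewrite (sb_triv S) subrr (sb_i0 S) circg1.
Qed.

Lemma sb_lam_i m y : lam (s m) (i y) = i (xi T m y).
Proof. by rewrite /lam (sb_lam S) mulKg. Qed.

Lemma sb_lam_is y m :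
  lam (i y) (s m) = s m * i (xi T m (eps T m y) - zeta T m y).
Proof.
rewrite /lam (sb_cconj S) (sb_lam S) -(sb_iN S) mulgA (sb_conj S) -mulgA -iD.
by rewrite addrC (morphN (zetaD _)).
Qed.

Lemma sb_lam_ii y z : lam (i y) (i z) = i z.
Proof. by rewrite /lam (sb_triv S) iD mulKg. Qed.

Lemma sb_lam_s m n : lam (s m) (s n) = s (lam m n)
  * i (g m^-1 (m \circ n) + zeta T (m \circ n) (- g m m^-1) + p m n).
Proof.
have := sb_invE S m 0; rewrite (sb_i0 S) mulg1 (morph0 (zetaD _)) subr0 => e.
by rewrite /lam (sb_circ S) e (sb_mulE S).
Qed.

Lemma sb_circ_i_cinv h m l :
  s h \circ i l \circ cinv (s h) \circ s m
  = s m \circ i (eps T (cinv h \circ m) l).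
Proof.
rewrite -!circA sb_cinv_circ (circA (i l)) (sb_cconj S) -circA (sb_triv S).
rewrite addrC -(sb_triv S) (circA (s _) (i _)) -sb_cinv_circ !circA circgV.
by rewrite circ1g.
Qed.

Definition sq_i v : square E := (i v.1, i v.2).

(** The two components may use different sections of [E]: the first factor of
the square carries the additive group, the second one the multiplicative
group. *)
Definition sq_s (s1 s2 : H -> E) x : square E := (s1 x.1, s2 x.2).

Lemma sq_mulE x v :
  sq_s s s x * sq_i v = (s x.1 * i (xi T x.2 v.1), s x.2 \circ i v.2).
Proof. by rewrite -[LHS]/(sq_mul _ _) /sq_mul /= sb_lam_i. Qed.

Lemma sq_section : sbSection (sq_triplet T) (@circ (square E)) sq_i (sq_s s s)
  (omegaSB T (g, p)).1 (omegaSB T (g, p)).2.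
Proof.
have sq_lamE x v : sq_s s s x \circ sq_i v = (s x.1 \circ i v.1,
    s x.2 \circ i (eps T (cinv x.1 \circ x.2) v.2)).
  by rewrite -[LHS]/(sq_circ _ _) /sq_circ /= sb_circ_i_cinv.
split.
- exact: circA.
- exact: circ_brace.
- move=> v w; rewrite -[RHS]/(sq_mul _ _) /sq_mul /sq_i /= sb_lam_ii.
  by rewrite (sb_triv S) iD.
- by move=> [k l] [k' l'] [/(sb_i_inj S)-> /(sb_i_inj S)->].
- by rewrite /sq_s /= (sb_s1 S).
- move=> [h1 g1] [h2 g2]; rewrite sq_mulE xiK_cinv -sb_circ_circ.
  rewrite -[LHS]/(sq_mul _ _) /sq_mul /= sb_lam_s mulgA (sb_mul S) -mulgA -iD.
  by rewrite !addrA.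
- move=> [h1 g1] [h2 g2]; rewrite sq_mulE -[LHS]/(sq_circ _ _) /sq_circ /=.
  rewrite xiK_cinv -(sb_circ S) -(circA _ (cinv _)) sb_cinv_circ circA.
  rewrite (sb_circ_circ h1 g2) -(circA (s _) (i _)) (sb_cconj S) (circA (s _)).
  rewrite (sb_circ_circ (h1 \circ g2)) -!circA !(sb_triv S).
  by rewrite !circA addrA.
- move=> v x; rewrite sq_mulE -[LHS]/(sq_mul _ _) /sq_mul /= sb_lam_is xiK_cinv.
  rewrite (sb_cconj S) mulgA (sb_conj S) -mulgA -iD.
  by rewrite (morphN (zetaD _)); congr (_ * i _, _); abel.
- move=> x v; rewrite sq_lamE sq_mulE (sb_lam S) /sq_xi /= -xiM.
  by rewrite circVKg.
- move=> v x; rewrite sq_lamE -[LHS]/(sq_circ _ _) /sq_circ /=.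
  rewrite -epsM circVKg !(sb_cconj S) -!circA sb_cinv_i !(sb_triv S).
  by rewrite epsD -epsM circVg eps1.
move=> [k l] [k' l']; rewrite -[LHS]/(sq_circ _ _) /sq_circ /= sb_cinv_i.
by rewrite !(sb_triv S); congr (i _, i _); rewrite /=; abel.
Qed.

End SquareSection.

(** * The map from skew brace cohomology to that of the square *)

Section OmegaSB.
Variables (H : skewBraceType) (I : zmodType) (T : goodTriplet H I).

Let xiD := aut_homD (xiP T).
Let zetaD := aut_antihomD (zetaP T).
Let epsD := aut_antihomD (epsP T).

Lemma omegaSBB : {morph @omegaSB H I T : c d / c - d}.
Proof.
move=> [g p] [g' p']; apply: injective_projections => /=.
  apply/funext=> -[h1 g1]; apply/funext=> -[h2 g2].
  apply: injective_projections; rewrite /= -(morphB (xiD _)) //.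
  congr (xi T _ _); rewrite !fctE !(morphN (zetaD _)) (morphB (zetaD _)); abel.
apply/funext=> -[h1 g1]; apply/funext=> -[h2 g2].
apply: injective_projections; rewrite /= !(morphB (xiD _)) //.
rewrite (morphB (epsD _)); abel.
Qed.

Lemma omegaSB_Z c : c \in Z2SB T -> omegaSB T c \in Z2SB (sq_triplet T).
Proof.
move=> Zc; have := sb_mem_Z (sq_section (ext_section (Cocycle Zc))).
by case: c Zc.
Qed.

(** The extension of [c] has a second section, with zero cocycle. Both
sections extend to its square, and [omegaSB] is linear, so [omegaSB c]
compares two sections of the square. *)
Lemma omegaSB_B c : c \in Z2SB T -> c \in B2SB T ->
  omegaSB T c \in B2SB (sq_triplet T).
Proof.
case: c => g p Zc /asboolP[theta B].
have S := ext_section (Cocycle Zc); have S0 := sb_untwist S B.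
pose th (x : square H) :=
  (xi T (cinv x.2) (theta x.1), xi T (cinv x.2) (theta x.2)).
have th1 : th 1 = 0.
  by case: B => theta1 _ _; rewrite /th /= theta1 !(morph0 (xiD _)).
rewrite -[omegaSB T (g, p)]subr0.
have <- : omegaSB T (0, 0) = 0 by have := omegaSBB 0 0; rewrite !subrr.
apply: (sb_sub_mem_B th1 (sq_section S0) (sq_section S)) => x.
rewrite (sq_mulE S0) /sq_s /= xiK_cinv -(sb_circ_i S0).
by rewrite -!mulgA -!(sb_iD S) !addNr (sb_i0 S) !mulg1.
Qed.

End OmegaSB.

(** * From relative Rota-Baxter to skew brace cohomology *)

Section Psi.
Variables (H : skewBraceType) (I : zmodType) (A : rrbModule H I).

Let nuD := aut_homD (nuP A).
Let nu1 := aut_hom1 (nuP A).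
Let nuM := aut_homM (nuP A).
Let muD := aut_antihomD (muP A).
Let sigmaD := aut_antihomD (sigmaP A).
Let sigmaM := aut_antihomM (sigmaP A).
Let mf_addl h : {morph (mf A)^~ h : k l / k + l}.
Proof. by move=> k l; exact: mfD. Qed.

Lemma psiB : {morph @psi H I A : c d / c - d}.
Proof.
move=> [[[t1 t2] rho] chi] [[[t1' t2'] rho'] chi'].
apply: injective_projections => //=.
apply/funext=> h1; apply/funext=> h2 /=; rewrite !fctE.
rewrite (morphB (mf_addl h2)) (morphB (nuD _)); abel.
Qed.

(** Write [p] for the second component. The condition on [chi] says that [p m
n] is the image under [nu (m \circ n)] of [t2 m n] plus the [sigma]-coboundary
of [chi], which gives the multiplicative condition. In the compatibility
condition the terms in [chi] cancel because [mf] is a cocycle in its second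
argument, and those in [rho] by the relation between [rho] and [t1]; what
remains is an identity for [t1] alone. *)
Lemma psi_Z c : c \in Z2RRB A -> psi A c \in Z2SB (rrb_triplet A).
Proof.
case: c => [[[t1 t2] rho] chi] /asboolP.
case=> [[t1r t1l] [t2r t2l] [rhor rhol] chi1 t1Z t2Z _ rhoZ chiZ].
set p := (psi A (t1, t2, rho, chi)).2.
have pE m n : p m n = nu A (m \circ n)
    (t2 m n + chi n - chi (m \circ n) + sigma A n (chi m)).
  rewrite chiZ -nuM circgV nu1 /p /=; abel.
rewrite -[psi A _]/(t1, p); apply/asboolP; split=> //=.
- have nu0 m := morph0 (nuD m); have sigma0 m := morph0 (sigmaD m).
  split=> m; rewrite pE ?t2r ?t2l chi1 ?circg1 ?circ1g.
    by rewrite (aut_antihom1 (sigmaP A)) -[RHS](nu0 m); congr nu; abel.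
  by rewrite sigma0 -[RHS](nu0 m); congr nu; abel.
- by move=> m1 m2 m3; apply: (add_eqn (t1Z m1 m2 m3)); abel.
- move=> m1 m2 m3.
  have e := congr1 (nu A (m1 \circ m2 \circ m3)) (t2Z m1 m2 m3).
  rewrite !pE -(nuM (cinv _)) circVg nu1 -!nuM !circA.
  rewrite !(sigmaD, morphN (sigmaD _)) -!sigmaM !(nuD, morphN (nuD _)) in e *.
  by apply: (add_eqn e); rewrite ?circA; abel.
move=> m1 m2 m3; have := rhoZ m2 m3 m1.
rewrite /p /= mfM !(lamM, nuD) nu_mu.
rewrite -[m1^-1 * (m1 \circ m3)]/(lam m1 m3) !(circE m1).
set a := lam m1 m2; set b := lam m1 m3.
rewrite !muD => e.
apply: (add_eqn e).
have e1 := t1Z m1 a b; have e2 := t1Z (m1 * a) m1^-1 (m1 * b).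
have e3 := t1Z m1 m1^-1 (m1 * b); rewrite mulgV t1l mulKg in e3.
rewrite mulKg in e2.
apply: (add_eqn e1); apply: (add_eqn e2); apply: (add_eqn (esym e3)); abel.
Qed.

(** [k2] drops out: its contributions to [rho] and to [chi] cancel. *)
Lemma psi_B c : c \in Z2RRB A -> c \in B2RRB A ->
  psi A c \in B2SB (rrb_triplet A).
Proof.
case: c => [[[t1 t2] rho] chi] _ /asboolP.
case=> [k1 [k2 [k11 k21 t1B t2B rhoB chiB]]].
apply/asboolP; exists k1; split=> // m n /=.
  by rewrite t1B; abel.
rewrite t1B rhoB chiB -circE nuM nu_sigma_mu.
set y := nu A (cinv m) (k1 m).
have -> : k1 m = nu A m y by rewrite /y -nuM circgV nu1.
rewrite (morphB (mf_addl n)) !(nuD, nu_mu, morphN (nuD _)); abel.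
Qed.

End Psi.

(** * Rota-Baxter operators and sections *)

Section Gamma.
Variables (H : skewBraceType) (I : zmodType) (A : rrbModule H I).
Implicit Types (x y : square H) (v w : I * I).

Let T := rrb_triplet A.

Lemma gammaE x v : gamma A x v = sq_zeta T x v.
Proof.
rewrite /gamma /sq_zeta /= nu_sigma_mu (morphN (aut_antihomD (muP A) _)).
by congr (nu A _ _, _); abel.
Qed.

Lemma gammaP : aut_antihom ( *%g : square H -> _) 1 (gamma A).
Proof.
split=> [x v w|v|x y v]; rewrite /= !gammaE.
- exact: aut_antihomD (sq_zetaP T) _ _ _.
- exact: aut_antihom1 (sq_zetaP T) _.
exact: aut_antihomM (sq_zetaP T) _ _ _.
Qed.

Lemma rbR_circ x y : rbR x * rbR y = rbR (x \circ y).
Proof.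
rewrite -[x \circ y]/(sq_circ x y) -[LHS]/(sq_mul _ _) /sq_mul /rbR /sq_circ /=.
by rewrite lam1 mulg1 !cinvM cinvK !circA circgVK.
Qed.

Lemma gamma_rbR x v :
  gamma A (rbR x) v = (nu A (cinv (cinv x.2 \circ x.1)) v.1,
                       sigma A (cinv x.2 \circ x.1) v.2).
Proof.
have mf1 l : mf A l 1 = 0.
  have := mfM A l 1 1; rewrite mulg1 (aut_antihom1 (muP A)) => e.
  by apply: (addrI (mf A l 1)); rewrite -e addr0.
by rewrite /gamma /= (aut_antihom1 (muP A)) mf1 addr0.
Qed.

Lemma sq_xi_gamma x v : sq_xi T x v = gamma A (rbR x)^-1 v.
Proof.
have -> : (rbR x)^-1 = rbR (x.2, x.1).
  by rewrite -[LHS]/(sq_inv _) /sq_inv /rbR /= invg1 lam1 cinvM cinvK.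
by rewrite gamma_rbR /sq_xi /= cinvM cinvK.
Qed.

Lemma gamma_rbI x v :
  gamma A x (v + rbI v) - rbI v = sq_xi T x (sq_eps T x v).
Proof.
rewrite sq_xi_eps -gammaE; congr (gamma A x _ + _).
  by apply: injective_projections; rewrite /= ?addr0 //; abel.
by apply: injective_projections; rewrite /= ?oppr0 //; abel.
Qed.

(** The compatibility of the Rota-Baxter operator of the kernel with [gamma]:
this is the Rota-Baxter identity on the pairs of an element of the kernel and
a value of the section. *)
Lemma rbI_gamma x v :
  rbI (gamma A (rbR x) (gamma A x (v + rbI v) - rbI v))
  = gamma A (rbR x) (rbI v).
Proof.
rewrite gamma_rbI sq_xi_gamma -(aut_antihomM gammaP) mulVg.
rewrite (aut_antihom1 gammaP) sq_epsE gamma_rbR /rbI /=.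
rewrite (morph0 (aut_homD (nuP A) _)); congr (_, _).
rewrite !(aut_antihomD (sigmaP A), morphN (aut_antihomD (sigmaP A) _)); abel.
Qed.

End Gamma.

Record rbSection (H : skewBraceType) (I : zmodType) (A : rrbModule H I)
    (X : groupType) (R : X -> X) (i : I * I -> X) (s : square H -> X)
    (t : square H -> square H -> I * I) (r : square H -> I * I) : Prop :=
  RbSection {
  rb_op : forall x y, R x * R y = R (x * R x * y * (R x)^-1);
  rb_iD : {morph i : v w / v + w >-> v * w};
  rb_i_inj : injective i;
  rb_s1 : s 1 = 1;
  rb_mul : forall x y, s x * s y = s (x * y) * i (t x y);
  rb_conj : forall v x, i v * s x = s x * i (gamma A x v);
  rb_R : forall x v,
    R (s x * i v) = s (rbR x) * i (r x + rbI (gamma A (rbR x) v))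
}.

Section RbSectionTheory.
Variables (H : skewBraceType) (I : zmodType) (A : rrbModule H I).
Variables (X : groupType) (R : X -> X) (i : I * I -> X).
Implicit Types (x y : square H) (v w : I * I).

Let T := sq_triplet (rrb_triplet A).
Let gD := aut_antihomD (gammaP A).
Let g1 := aut_antihom1 (gammaP A).
Let gM := aut_antihomM (gammaP A).

Definition rbCirc (a b : X) : X := a * R a * b * (R a)^-1.

Section Theory.
Variables (s : square H -> X).
Variables (t : square H -> square H -> I * I) (r : square H -> I * I).
Hypothesis S : rbSection A R i s t r.
Let iD := rb_iD S.

Lemma rb_i0 : i 0 = 1.
Proof. by apply: (mulgI (i 0)); rewrite -iD addr0 mulg1. Qed.

Lemma rb_iN v : i (- v) = (i v)^-1.
Proof. by apply: (mulgI (i v)); rewrite -iD subrr mulgV rb_i0. Qed.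

Lemma rb_mulE x y v w :
  s x * i v * (s y * i w) = s (x * y) * i (t x y + gamma A y v + w).
Proof.
by rewrite mulgA -(mulgA (s x)) (rb_conj S) mulgA (rb_mul S) !iD !mulgA.
Qed.

Lemma rb_invE x v :
  (s x * i v)^-1 = s x^-1 * i (- t x x^-1 - gamma A x^-1 v).
Proof.
apply: (mulgI (s x * i v)); rewrite rb_mulE !mulgV (rb_s1 S) mul1g -rb_i0.
by congr i; abel.
Qed.

Lemma rb_Rs x : R (s x) = s (rbR x) * i (r x).
Proof.
by rewrite -[s x]mulg1 -rb_i0 (rb_R S) (morph0 (gD _)) (morph0 (@rbID _)) addr0.
Qed.

Lemma rb_R1 : R 1 = 1.
Proof.
have := rb_op S 1 1; rewrite !mulg1 mul1g mulgV => /(canRL (mulgK _)).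
by rewrite mulgV.
Qed.

Lemma rb_r1 : r 1 = 0.
Proof.
have := rb_Rs 1; rewrite (rb_s1 S) rb_R1 /rbR /= cinv1 circ1g.
by rewrite -[(1, 1)]/(1 : square H) (rb_s1 S) mul1g -rb_i0 => /(rb_i_inj S).
Qed.

Lemma rb_Ri v : R (i v) = i (rbI v).
Proof.
rewrite -[i v]mul1g -(rb_s1 S) (rb_R S) rb_r1 add0r /rbR /= cinv1 circ1g.
by rewrite -[(1, 1)]/(1 : square H) (rb_s1 S) mul1g g1.
Qed.

Lemma rb_conjV x v w :
  s x * i w * i v * (s x * i w)^-1 = i (gamma A x^-1 v).
Proof.
apply: (mulIg (s x * i w)); rewrite mulgVK mulgA (rb_conj S) -gM mulVg g1.
by rewrite -!mulgA -!iD addrC.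
Qed.

(** The formula for [psiT] is the product [s x * (R (s x) * s y * R (s x)^-1)]
in normal form. *)
Lemma rb_sbSection :
  sbSection T rbCirc i s (psiT A (t, r)).1 (psiT A (t, r)).2.
Proof.
have g0 x := morph0 (gD x).
have lamE x v : rbCirc (s x) (i v) = s x * i (xi T x v).
  by rewrite /rbCirc -!(mulgA (s x)) rb_Rs rb_conjV /= sq_xi_gamma.
split.
- by move=> a b c; rewrite /rbCirc -(rb_op S) invgM !mulgA mulgVK.
- by move=> a b c; rewrite /rbCirc !mulgA !mulgVK.
- exact: iD.
- exact: rb_i_inj S.
- exact: rb_s1 S.
- exact: rb_mul S.
- move=> x y; rewrite /rbCirc -!(mulgA (s x)) rb_Rs rb_invE.
  rewrite -[s x]mulg1 -[s y]mulg1 -rb_i0 !rb_mulE !g0 !(gD, morphN (gD _)).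
  rewrite -[x \circ y]/(sq_circ x y) sq_circE !mulgA.
  by congr (_ * i _); rewrite /= !(gD, morphN (gD _), g0); abel.
- by move=> v x; rewrite (rb_conj S) gammaE.
- exact: lamE.
- move=> v x; rewrite lamE /= -gamma_rbI {1}/rbCirc rb_Ri -iD (rb_conj S).
  by rewrite -rb_iN -mulgA -iD.
move=> v w; rewrite /rbCirc rb_Ri -rb_iN -!iD; congr i; abel.
Qed.

(** The second condition is the identity for [R] at [s x] and [s y], with its
argument bracketed as [(s x * R (s x)) * (s y * R (s x)^-1)]. *)
Lemma rb_mem_Z : (t, r) \in Z2RB A.
Proof.
have [[tr tl] _ tZ _ _] := sbZ rb_sbSection.
apply/asboolP; split=> //; first exact: rb_r1.
  move=> x y z; have := tZ x y z; rewrite /= -gammaE => e.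
  by apply: (add_eqn e); abel.
move=> x y R1 R2; have g0 z := morph0 (gD z).
have := rb_op S (s x) (s y); rewrite -mulgA !rb_Rs rb_invE -/R1 -/R2.
rewrite -[s x]mulg1 -[s y]mulg1 -rb_i0 !rb_mulE (rb_R S) !mulgA.
rewrite -sq_circE -/(x \circ y).
rewrite -rbR_circ -/R1 -/R2 => /mulgI/(rb_i_inj S) e.
rewrite addrA in e.
apply: (etrans e); congr (_ + rbI _).
rewrite !g0 !(gD, morphN (gD _)) -!gM !mulgA !mulgVK mulVg mul1g !g0.
abel.
Qed.

Lemma rb_untwist theta : B2RB_spec A t r theta ->
  rbSection A R i (fun x => s x * i (- theta x)) (fun _ _ => 0) (fun _ => 0).
Proof.
case=> theta1 tE rE; split.
- exact: rb_op S.
- exact: iD.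
- exact: rb_i_inj S.
- by rewrite theta1 oppr0 rb_i0 mulg1 (rb_s1 S).
- move=> x y; rewrite rb_mulE tE rb_i0 mulg1 (morphN (gD _)).
  by congr (_ * i _); abel.
- by move=> v x; rewrite mulgA (rb_conj S) -!mulgA -!iD addrC.
move=> x v; rewrite -!mulgA -!iD (rb_R S) rE; congr (_ * i _).
by rewrite !(gD, morphN (gD _), @rbID I, morphN (@rbID I)); abel.
Qed.

End Theory.

End RbSectionTheory.

Section RotaBaxterExtension.
Variables (H : skewBraceType) (I : zmodType) (A : rrbModule H I).
Variable c : cocycle (Z2RB A).

Let gD := aut_antihomD (gammaP A).
Let g1 := aut_antihom1 (gammaP A).
Let gM := aut_antihomM (gammaP A).

Let t := (cochain c).1.
Let r := (cochain c).2.

Lemma rb_cocycle_spec : Z2RB_spec A t r.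
Proof. by rewrite /t /r; case: c => -[? ?] /= /asboolP. Qed.

Lemma rb_norm : normalized2 t. Proof. by case: rb_cocycle_spec. Qed.

Lemma rb_cocycle x y z : t y z + t x (y * z) = t (x * y) z + gamma A z (t x y).
Proof. by case: rb_cocycle_spec. Qed.

Definition rb_gcoc : groupCocycle (square H) (I * I)%type :=
  GroupCocycle (gammaP A) rb_norm rb_cocycle.

(** The only operator compatible with the field [rb_R] of [rbSection]. *)
Definition ext_R (a : ext rb_gcoc) : ext rb_gcoc :=
  (rbR a.1, r a.1 + rbI (gamma A (rbR a.1) a.2)).

(** The cocycle condition is the case [v = w = 0]; the terms in [w] agree on
both sides, and those in [v] agree by [rbI_gamma]. *)
Lemma ext_R_op a b : ext_R a * ext_R b = ext_R (a * ext_R a * b * (ext_R a)^-1).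
Proof.
case: a b => [x v] [y w]; rewrite -mulgA ext_invE !ext_mulE /ext_R /=.
rewrite !mulgA -sq_circE -/(x \circ y) -rbR_circ; congr (_, _).
case: rb_cocycle_spec => _ _ _ /(_ x y) /= e.
have e' := rbI_gamma A y (gamma A (rbR x) v).
have gV z u : gamma A z (gamma A z^-1 u) = u by rewrite -gM mulVg g1.
apply: (add_eqn e); apply: (add_eqn (esym e')); rewrite addrA.
rewrite !(gD, morphN (gD _), @rbID I, morphN (@rbID I)) -!gM !mulgA.
rewrite !mulgVK !(mulVg, mul1g); abel.
Qed.

Definition rb_ext_i (v : I * I) : ext rb_gcoc := (1, v).
Definition rb_ext_s (x : square H) : ext rb_gcoc := (x, 0).

Lemma ext_rbSection : rbSection A ext_R rb_ext_i rb_ext_s t r.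
Proof.
have [tr tl] := rb_norm; have g0 x := morph0 (gD x).
split.
- exact: ext_R_op.
- by move=> v w; rewrite ext_mulE /= mulg1 tr g1 add0r.
- by move=> v w [].
- by [].
- by move=> x y; rewrite !ext_mulE /= mulg1 tr !(g1, g0, add0r, addr0).
- move=> v x; rewrite !ext_mulE /= mulg1 mul1g tr tl.
  by rewrite !(g1, g0, addr0, add0r).
move=> x v; rewrite !ext_mulE /ext_R /= !mulg1 !tr !g1.
by rewrite !(g0, add0r).
Qed.

End RotaBaxterExtension.

(** * From Rota-Baxter to skew brace cohomology of the square *)

Section PsiT.
Variables (H : skewBraceType) (I : zmodType) (A : rrbModule H I).

Let gD := aut_antihomD (gammaP A).

Lemma psiTB : {morph @psiT H I A : c d / c - d}.
Proof.
move=> [t r] [t' r']; apply: injective_projections => //=.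
apply/funext=> x; apply/funext=> y; rewrite /= !fctE.
rewrite !(gD, morphN (gD _)); abel.
Qed.

Lemma psiT_Z c : c \in Z2RB A -> psiT A c \in Z2SB (sq_triplet (rrb_triplet A)).
Proof.
move=> Zc; have := sb_mem_Z (rb_sbSection (ext_rbSection (Cocycle Zc))).
by case: c Zc.
Qed.

(** As for [omegaSB_B]: the section twisted by [- theta] has zero cocycle. *)
Lemma psiT_B c : c \in Z2RB A -> c \in B2RB A ->
  psiT A c \in B2SB (sq_triplet (rrb_triplet A)).
Proof.
case: c => t r Zc /asboolP[theta B].
have S := ext_rbSection (Cocycle Zc); have S0 := rb_untwist S B.
have th1 : theta 1 = 0 by case: B.
rewrite -[psiT A (t, r)]subr0.
have <- : psiT A (0, 0) = 0 by have := psiTB 0 0; rewrite !subrr.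
apply: (sb_sub_mem_B th1 (rb_sbSection S0) (rb_sbSection S)) => x.
by rewrite -mulgA -(rb_iD S) addNr (rb_i0 S) mulg1.
Qed.

End PsiT.

(** * From relative Rota-Baxter to Rota-Baxter cohomology *)

Section OmegaRB.
Variables (H : skewBraceType) (I : zmodType) (A : rrbModule H I).

Let nuD := aut_homD (nuP A).
Let nu1 := aut_hom1 (nuP A).
Let nuM := aut_homM (nuP A).
Let nu0 h := morph0 (nuD h).
Let sigmaD := aut_antihomD (sigmaP A).
Let mf_addl h : {morph (mf A)^~ h : k l / k + l}.
Proof. by move=> k l; exact: mfD. Qed.

Section Theory.
Variables (t1 t2 rho : H -> H -> I) (chi : H -> I).
Hypothesis Zc : Z2RRB_spec A t1 t2 rho chi.
Let c : C2RRB H I := (t1, t2, rho, chi).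

Variables (E : skewBraceType) (i : I -> E) (s : H -> E).
Hypothesis S : sbSection (rrb_triplet A) (@circ E) i s (psi A c).1 (psi A c).2.
Implicit Types (x : square H) (v w : I * I).

(** In the language of relative Rota-Baxter groups, [s g] is the image under
the operator of the chosen lift of [g] to the additive extension, and [chi]
measures its distance to the chosen lift [circ_shift g] to the multiplicative
one. *)
Definition circ_shift (g : H) : E := s g \circ i (- chi g).
Local Notation s2 := circ_shift.

Lemma circ_shiftK g : s2 g \circ i (chi g) = s g.
Proof. by rewrite /s2 -circA (sb_triv S) addNr (sb_i0 S) circg1. Qed.

Lemma circ_shift_conj l g : i l \circ s2 g = s2 g \circ i (sigma A g l).
Proof.
by rewrite /s2 circA (sb_cconj S) -!circA !(sb_triv S) addrC.
Qed.

(** By the condition on [chi], removing [chi] turns the multiplicative cocycle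
of [s] into [t2]. *)
Lemma circ_shiftM g h : s2 g \circ s2 h = s2 (g \circ h) \circ i (t2 g h).
Proof.
rewrite {2}/s2 circA.
have -> : s2 g \circ s h
    = s (g \circ h) \circ i (t2 g h + chi h - chi (g \circ h)).
  rewrite /s2 -circA (sb_cconj S) circA (sb_circ_circ S) -circA (sb_triv S).
  congr (_ \circ i _); case: Zc => _ _ _ _ _ _ _ _ /(_ g h) e.
  apply: (add_eqn (esym e)); rewrite /= !(nuD, morphN (sigmaD _)); abel.
rewrite -circA (sb_triv S) -circ_shiftK -circA (sb_triv S).
by congr (_ \circ i _); abel.
Qed.

Lemma lam_circ_shift_i g k : lam (s2 g) (i k) = i (nu A g k).
Proof. by rewrite /s2 lam_circ (sb_lam_ii S) (sb_lam_i S). Qed.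

(** The factor [i (- chi g)] of [s2 g] changes [s h] by [- mf (chi g) h],
which cancels the term in [chi] of [psi]; only [rho] is left. *)
Lemma lam_circ_shift_s g h : lam (s2 g) (s h) = s (lam g h) * i (rho h g).
Proof.
rewrite /s2 lam_circ (sb_lam_is S) lamM (sb_lam_i S) /= nu_sigma_mu.
apply: (mulgI (s g)); rewrite mulgA -circE (sb_circ S) mulgA (sb_mul S) -circE.
rewrite -!mulgA -!(sb_iD S); congr (_ * i _).
rewrite /= (morphN (mf_addl h)) (addrC (mu A _ _)) addrK (morphN (nuD _)); abel.
Qed.

Lemma sq_shift_mulE x v :
  sq_s s s2 x * sq_i i v = (s x.1 * i (nu A x.2 v.1), s2 x.2 \circ i v.2).
Proof. by rewrite -[LHS]/(sq_mul _ _) /sq_mul /= lam_circ_shift_i. Qed.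

Lemma omegaRB_section :
  rbSection A (@rbR E) (sq_i i) (sq_s s s2) (omegaRB A c).1 (omegaRB A c).2.
Proof.
have Sq := sq_section S; have nuK g k : nu A g (nu A (cinv g) k) = k.
  by rewrite -nuM circgV nu1.
split.
- by move=> x y; rewrite rbR_circ -sq_circE.
- exact: sb_iD Sq.
- exact: sb_i_inj Sq.
- case: Zc => _ _ _ chi1 _ _ _ _ _.
  by rewrite /sq_s /s2 /= chi1 oppr0 (sb_i0 S) circg1 (sb_s1 S).
- move=> [h1 g1] [h2 g2]; rewrite sq_shift_mulE -[LHS]/(sq_mul _ _) /sq_mul /=.
  rewrite circ_shiftM lam_circ_shift_s mulgA (sb_mul S) -mulgA -(sb_iD S).
  by rewrite nuK.
- move=> v x; rewrite sq_shift_mulE -[LHS]/(sq_mul _ _) /sq_mul /=.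
  rewrite circ_shift_conj (sb_lam_is S) nuK mulgA (sb_conj S) -mulgA -(sb_iD S).
  by rewrite /= nu_sigma_mu (addrC (mu A _ v.2)) addrK.
move=> x v; case: x => h g; rewrite !sq_shift_mulE gamma_rbR /rbR /=.
rewrite addr0 nu0 (sb_i0 S) mulg1 (sb_s1 S); congr (_, _).
have e : s2 h
    = s2 g \circ s2 (cinv g \circ h) \circ i (- t2 g (cinv g \circ h)).
  by rewrite circ_shiftM circVKg -circA (sb_triv S) subrr (sb_i0 S) circg1.
rewrite cinvM (sb_cinv_i S) (sb_circ_i S) /= -(circ_shiftK h) e.
rewrite -(circA _ (cinv _)) -!(circA (s2 g)) circKg -!(circA (s2 _)).
rewrite (circA (i _)) circ_shift_conj -(circA (s2 _)) !(sb_triv S).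
congr (_ \circ i _); rewrite cinvM cinvK nuM (morphN (sigmaD _)); abel.
Qed.

End Theory.

Lemma omegaRBB : {morph @omegaRB H I A : c d / c - d}.
Proof.
move=> [[[t1 t2] rho] chi] [[[t1' t2'] rho'] chi'].
apply: injective_projections => /=.
  apply/funext=> -[h1 g1]; apply/funext=> -[h2 g2].
  apply: injective_projections => //=; rewrite -(morphB (nuD _)).
  by congr (nu A _ _); rewrite !fctE; abel.
apply/funext=> -[h g]; apply: injective_projections; rewrite /= ?subr0 //.
by rewrite !fctE; abel.
Qed.

Lemma omegaRB_Z c : c \in Z2RRB A -> omegaRB A c \in Z2RB A.
Proof.
case: c => [[[t1 t2] rho] chi] Zc; have /asboolP Zs := Zc.
exact: rb_mem_Z (omegaRB_section Zs (ext_section (Cocycle (psi_Z Zc)))).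
Qed.

(** The twists [k1] and [k2] of the two sections combine to a twist of [(s,
s2)]; the normal form [s h * i (nu g k)] of the first component accounts for
the inverse of [nu g]. *)
Lemma omegaRB_B c : c \in Z2RRB A -> c \in B2RRB A -> omegaRB A c \in B2RB A.
Proof.
case: c => [[[t1 t2] rho] chi] _ /asboolP.
case=> [k1 [k2 [k11 k21 t1B t2B rhoB chiB]]].
apply/asboolP; exists (fun x => (nu A (cinv x.2) (k1 x.1), k2 x.2)); split.
- by rewrite /normalized1 /= k11 k21 nu0.
- move=> [h1 g1] [h2 g2].
  rewrite -[_ * _]/(sq_mul (h1, g1) (h2, g2)) /sq_mul /gamma /=.
  rewrite t1B t2B rhoB; apply: injective_projections => /=; last by abel.
  have nuVK k : nu A (cinv g1) (nu A g1 k) = k by rewrite -nuM circVg nu1.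
  have -> y : mu A (lam g1 h2) y = nu A g1 (mu A h2 (nu A (cinv g1) y)).
    by rewrite nu_mu -nuM circgV nu1.
  by rewrite !cinvM !(nuD, morphN (nuD _)) !nuM !nuVK; abel.
move=> [h g]; rewrite gamma_rbR /rbR /=; apply: injective_projections => /=.
  by rewrite k11 nu0 subr0.
by rewrite t2B chiB circVKg cinvM cinvK nuM -(nuM g) circgV nu1; abel.
Qed.

(** On the square of the extension of [psi c], the operation [rbCirc rbR] is
the multiplicative one, so both cochains are cocycles of sections of one and
the same skew brace. *)
Lemma psiT_omegaRB c : c \in Z2RRB A ->
  psiT A (omegaRB A c) - omegaSB (rrb_triplet A) (psi A c)
    \in B2SB (sq_triplet (rrb_triplet A)).
Proof.
case: c => [[[t1 t2] rho] chi] Zc; have /asboolP Zs := Zc.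
have S := ext_section (Cocycle (psi_Z Zc)).
have := rb_sbSection (omegaRB_section Zs S).
have -> : rbCirc (@rbR _) = @circ _.
  by move=> E; apply/funext => x; apply/funext => y; rewrite /rbCirc -sq_circE.
move=> Srb.
pose th (x : square H) : I * I := (0, - chi x.2).
have th1 : th 1 = 0.
  by case: Zs => _ _ _ chi1 _ _ _ _ _; rewrite /th /= chi1 oppr0.
apply: (sb_sub_mem_B th1 (sq_section S) Srb) => x.
rewrite (sq_mulE S) /= (morph0 (nuD _)) (sb_i0 S) mulg1.
by [].
Qed.

End OmegaRB.

(** * The commutative square *)

Theorem theorem5p1 (H : skewBraceType) (I : zmodType) (A : rrbModule H I) :
  exists (Psi : {additive H2RRB A -> H2SB (rrb_triplet A)})
         (OmegaRB : {additive H2RRB A -> H2RB A})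
         (PsiT : {additive H2RB A -> H2SB (sq_triplet (rrb_triplet A))})
         (OmegaSB : {additive H2SB (rrb_triplet A)
                     -> H2SB (sq_triplet (rrb_triplet A))}),
    [/\ induced_by (psi A) Psi,
        induced_by (omegaRB A) OmegaRB,
        induced_by (psiT A) PsiT,
        induced_by (omegaSB (rrb_triplet A)) OmegaSB
      & forall x : H2RRB A, PsiT (OmegaRB x) = OmegaSB (Psi x)].
Proof.
have [Psi PsiP] := induced_map (psiB A) (@psi_Z _ _ A) (@psi_B _ _ A).
have [OmRB OmRBP] :=
  induced_map (omegaRBB A) (@omegaRB_Z _ _ A) (@omegaRB_B _ _ A).
have [PsiT PsiTP] := induced_map (psiTB A) (@psiT_Z _ _ A) (@psiT_B _ _ A).
have [OmSB OmSBP] := induced_map (@omegaSBB _ _ (rrb_triplet A))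
  (@omegaSB_Z _ _ (rrb_triplet A)) (@omegaSB_B _ _ (rrb_triplet A)).
exists Psi, OmRB, PsiT, OmSB; split=> // x.
have [c ->] := cls_surj x.
have [[a Za] /= aE ->] := OmRBP c.
have [[a' Za'] /= a'E ->] := PsiTP (Cocycle Za).
have [[b Zb] /= bE ->] := PsiP c.
have [[b' Zb'] /= b'E ->] := OmSBP (Cocycle Zb).
apply/eqP; rewrite cls_eq /= a'E b'E aE bE.
exact: psiT_omegaRB (valP c).
Qed.
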